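(* Let $a[0..n-1]$ and $b[0..m-1]$ be boolean arrays, and let $c[0..n+m-2]$ be their boolean convolution, $c[i]=\bigvee_{j+k=i}(a[j]\wedge b[k])$. For every index $i$ with $c[i]>0$ let $x[i]=\{k\mid a[k]=b[i-k]=1\}$. If $\sigma$ is a lexical order (permutation of the indices $\{0,\dots,n-1\}$) chosen uniformly at random among all $n!$ permutations, then in expected $\tilde O(n+m)$ time one can compute an array $d[0..n+m-1]$ such that for every index $i$ with $c[i]>0$, $d[i]$ is the element of $x[i]$ that is smallest with respect to $\sigma$ (i.e. appears earliest in $\sigma$).
   Context: $\tilde O$ hides polylogarithmic factors. A lexical order $\sigma=(\sigma_0,\sigma_1,\dots)$ is a permutation of the index set; elements appearing earlier in $\sigma$ are considered smaller. *)

(* Defs.v *)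
From mathcomp Require Import all_boot all_order all_fingroup all_algebra.

Set Implicit Arguments.
Unset Strict Implicit.
Unset Printing Implicit Defensive.

(** * Model of computation

   Random access machine under the logarithmic cost criterion (Aho, Hopcroft
   and Ullman), presented as a structured language.  The memory consists of
   arrays, named by literals of the program, whose cells hold natural numbers.
   An operation costs the number of bits of the values and addresses it handles.
   Since N-bit multiplication and division take N * polylog(N) bit operations,
   running times here agree, up to polylogarithmic factors, with those on a
   word RAM with words of logarithmic length. *)

Definition store := nat -> nat -> nat.

Definition update (s : store) (A i v : nat) : store :=
  fun A' i' => if (A' == A) && (i' == i) then v else s A' i'.

(** Subtraction is truncated and division by zero yields zero. *)
Inductive binop := Add | Sub | Mul | Div.

Definition eval_op (o : binop) : nat -> nat -> nat :=
  match o with Add => addn | Sub => subn | Mul => muln | Div => divn end.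

Inductive expr :=
| Num of nat
| Get of nat & expr
| Bin of binop & expr & expr.

Inductive cmd :=
| Skip
| Assign of nat & expr & expr
| Seq of cmd & cmd
| If of expr & cmd & cmd
| While of expr & cmd.

Definition bits (k : nat) : nat := (trunc_log 2 k).+1.

Fixpoint eval (s : store) (e : expr) : nat :=
  match e with
  | Num k => k
  | Get A e1 => s A (eval s e1)
  | Bin o e1 e2 => eval_op o (eval s e1) (eval s e2)
  end.

Fixpoint cost (s : store) (e : expr) : nat :=
  match e with
  | Num k => bits k
  | Get A e1 => cost s e1 + bits (eval s e1) + bits (eval s e)
  | Bin _ e1 e2 =>
      cost s e1 + cost s e2 + bits (eval s e1) + bits (eval s e2)
  end.

(** [exec p s t s']: started in [s], the program [p] halts in [s'] after time
   [t].  Conditions are true when nonzero. *)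
Inductive exec : cmd -> store -> nat -> store -> Prop :=
| ExecSkip s : exec Skip s 1 s
| ExecAssign A e1 e2 s :
    exec (Assign A e1 e2) s
      (cost s e1 + cost s e2 + bits (eval s e1) + bits (eval s e2))
      (update s A (eval s e1) (eval s e2))
| ExecSeq p q s t s' t' s'' :
    exec p s t s' -> exec q s' t' s'' -> exec (Seq p q) s (t + t') s''
| ExecIfTrue e p q s t s' :
    eval s e != 0 -> exec p s t s' ->
    exec (If e p q) s (cost s e + bits (eval s e) + t) s'
| ExecIfFalse e p q s t s' :
    eval s e = 0 -> exec q s t s' ->
    exec (If e p q) s (cost s e + bits (eval s e) + t) s'
| ExecWhileTrue e p s t s' t' s'' :
    eval s e != 0 -> exec p s t s' -> exec (While e p) s' t' s'' ->
    exec (While e p) s (cost s e + bits (eval s e) + t + t') s''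
| ExecWhileFalse e p s :
    eval s e = 0 -> exec (While e p) s (cost s e + bits (eval s e)) s.

(** The running time and the result of a halting run are unique. *)
Lemma exec_det p s t1 s1 t2 s2 :
  exec p s t1 s1 -> exec p s t2 s2 -> t1 = t2 /\ s1 = s2.
Proof.
move=> E1; elim: E1 t2 s2 => {p s t1 s1}.
- by move=> s t2 s2 E; inversion E; subst.
- by move=> A e1 e2 s t2 s2 E; inversion E; subst.
- move=> p q s t s' t' s'' _ IHp _ IHq t2 s2 E; inversion E; subst.
  have [? ?] := IHp _ _ ltac:(eassumption); subst.
  by have [? ?] := IHq _ _ ltac:(eassumption); subst.
- move=> e p q s t s' ne0 _ IH t2 s2 E; inversion E; subst.
    by have [? ?] := IH _ _ ltac:(eassumption); subst.
  by move/eqP: ne0.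
- move=> e p q s t s' e0 _ IH t2 s2 E; inversion E; subst.
    by move: e0 => /eqP; rewrite (negbTE ltac:(eassumption)).
  by have [? ?] := IH _ _ ltac:(eassumption); subst.
- move=> e p s t s' t' s'' ne0 _ IHp _ IHw t2 s2 E; inversion E; subst.
    have [? ?] := IHp _ _ ltac:(eassumption); subst.
    by have [? ?] := IHw _ _ ltac:(eassumption); subst.
  by move/eqP: ne0.
- move=> e p s e0 t2 s2 E; inversion E; subst => //.
  by move: e0 => /eqP; rewrite (negbTE ltac:(eassumption)).
Qed.

(** * Boolean convolution and its witnesses *)

Definition conv n m (a : n.-tuple bool) (b : m.-tuple bool) :
    (n + m).-1.-tuple bool :=
  [tuple \big[orb/false]_(p : 'I_n * 'I_m | p.1 + p.2 == i)
           (tnth a p.1 && tnth b p.2) | i < (n + m).-1].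

(** The guard [k <= i] is needed because [i - k] is truncated; out-of-range
   entries of [b] read as [false]. *)
Definition witnesses n m (a : n.-tuple bool) (b : m.-tuple bool) (i : nat) :
    {set 'I_n} :=
  [set k : 'I_n | [&& k <= i, tnth a k & nth false b (i - k)]].

(** The lexical order is (sigma 0, sigma 1, ...), so that the position of [k] in
   it is [sigma^-1 k]. *)
Definition lex_smallest n (sigma : 'S_n) (X : {set 'I_n}) (k : 'I_n) : Prop :=
  k \in X /\ forall k', k' \in X -> (sigma^-1)%g k <= (sigma^-1)%g k'.

(** * Input, output, expectation *)

(** Array 0 holds the lengths; arrays 1, 2, 3 hold a, b, sigma; all other cells
   are zero. *)
Definition input n m (a : n.-tuple bool) (b : m.-tuple bool) (sigma : 'S_n) :
    store :=
  fun A i => nth 0 (nth [::] [:: [:: n; m]; map nat_of_bool a;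
    map nat_of_bool b; [seq val (sigma j) | j <- enum 'I_n]] A) i.

(** The output is read off array 4. *)
Definition output (len : nat) (s : store) : seq nat := mkseq (s 4) len.

Definition expectation n (T : 'S_n -> nat) : rat :=
  ((\sum_(sigma : 'S_n) (T sigma)%:R) / (n`!)%:R)%R.

(* Main.v *)
Require Import Defs.
From mathcomp Require Import all_boot all_order all_fingroup all_algebra.
From mathcomp Require Import zify.
Import Defs.

Set Implicit Arguments.
Unset Strict Implicit.
Unset Printing Implicit Defensive.

(** Write [p] for the position in the order, so that the wanted witness of [i] is
   the one of smallest position.  For each prefix of length [2 ^ l] of the order
   and each residue class [c] modulo [q <= Q], one boolean convolution with weights
   [1 + N * p], restricted to the positions of the prefix in the class, yields both
   the number and the sum of the positions of the witnesses of every [i]; a number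
   equal to one reveals a position, and the least position revealed is kept.

   If the first prefix that meets the positions of [i] contains at most
   [2 log N] of them, then each is isolated by some [q]: otherwise the product of
   its differences with the others would be divisible by all numbers up to [Q],
   hence by a central binomial coefficient exceeding it.  That some first
   nonempty prefix is more crowded has probability at most [log N / N], because in
   a random order a set missing the first half of a prefix has [k] or more elements
   in the second half with probability at most [2 ^ -k]; in that case a quadratic
   algorithm is affordable.

   The convolutions are computed by Kronecker substitution: a single product of
   huge integers, assembled and taken apart along a binary tree in which each of
   the [log N] levels has [N * polylog N] bits. *)

(** * Running times and frames *)

Declare Scope prog_scope.
Delimit Scope prog_scope with P.
Infix "+" := (Bin Add) : prog_scope.
Infix "-" := (Bin Sub) : prog_scope.
Infix "*" := (Bin Mul) : prog_scope.
Infix "/" := (Bin Div) : prog_scope.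
Notation lit := Num.
Notation var x := (Get x (Num 0)).
Notation set_var x e := (Assign x (Num 0) e).
Notation "A @[ e ]" := (Get A e%P) (at level 2, left associativity, format "A @[ e ]").
Notation "p ;; q" := (Seq p q) (at level 85, right associativity).

Fixpoint mods (c : cmd) : seq nat :=
  match c with
  | Skip => [::]
  | Assign A _ _ => [:: A]
  | Seq p q | If _ p q => mods p ++ mods q
  | While _ p => mods p
  end.

Definition agree (ms : seq nat) (s s' : store) :=
  forall A i, A \notin ms -> s' A i = s A i.

Lemma agree_trans ms s1 s2 s3 :
  agree ms s1 s2 -> agree ms s2 s3 -> agree ms s1 s3.
Proof. by move=> h1 h2 A i hA; rewrite h2 // h1. Qed.

Lemma agree_sub ms ms' s s' :
  {subset ms <= ms'} -> agree ms s s' -> agree ms' s s'.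
Proof. by move=> sub h A i hA; apply: h; apply: contra hA; apply: sub. Qed.

Lemma updateE s A i v A' i' :
  update s A i v A' i' = if (A' == A) && (i' == i) then v else s A' i'.
Proof. by []. Qed.

Lemma agree_update s A i v ms : A \in ms -> agree ms s (update s A i v).
Proof.
by move=> hA A' i' hA'; rewrite updateE; case: eqP => // e; rewrite e hA in hA'.
Qed.

Lemma exec_agree c s t s' : exec c s t s' -> agree (mods c) s s'.
Proof.
elim=> {c s t s'} //=.
- by move=> A e1 e2 s; apply: agree_update; rewrite inE.
- move=> p q s t s' t' s'' _ h1 _ h2; apply: agree_trans.
    by apply: agree_sub h1 => x; rewrite mem_cat => ->.
  by apply: agree_sub h2 => x; rewrite mem_cat => ->; rewrite orbT.
- move=> e p q s t s' _ _; apply: agree_sub => x.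
  by rewrite mem_cat => ->.
- move=> e p q s t s' _ _; apply: agree_sub => x.
  by rewrite mem_cat => ->; rewrite orbT.
- by move=> e p s t s' t' s'' _ _ h1 _ h2; apply: agree_trans h1 h2.
Qed.

(** Total correctness with a time budget. The postcondition comes last, so that specifications nest
    under [runs_seq]. *)
Definition runs c s t (Q : store -> Prop) :=
  exists t' s', [/\ exec c s t' s', t' <= t & Q s'].

Lemma runs_weaken c s t t' (Q Q' : store -> Prop) :
  t <= t' -> (forall s', agree (mods c) s s' -> Q s' -> Q' s') ->
  runs c s t Q -> runs c s t' Q'.
Proof.
move=> le_t h [t0 [s0 [ex le0 q]]]; exists t0, s0; split=> //.
  exact: leq_trans le0 le_t.
by apply: h q; apply: exec_agree ex.
Qed.

(** Gives every postcondition the frame fact for free: an execution only changes arrays in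
    [mods c]. *)
Lemma runs_frame c s t (Q : store -> Prop) :
  runs c s t (fun s' => agree (mods c) s s' -> Q s') -> runs c s t Q.
Proof. by apply: runs_weaken => // s' h; apply. Qed.

Lemma runs_seq p q s t1 t2 Q :
  runs p s t1 (fun s' => runs q s' t2 Q) -> runs (Seq p q) s (t1 + t2) Q.
Proof.
move=> [t [s' [ex le1 [t' [s'' [ex' le2 h]]]]]].
by exists (t + t'), s''; split=> //; [apply: ExecSeq ex ex' | apply: leq_add].
Qed.

(** A literal counts with its value, so that [reads_eval] holds for it with any positive [w]. *)
Fixpoint esize (e : expr) : nat :=
  match e with
  | lit k => k.+1
  | Get _ e1 => (esize e1).+1
  | Bin _ e1 e2 => (esize e1 + esize e2).+1
  end.

Fixpoint reads (w : nat) (s : store) (e : expr) : Prop :=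
  match e with
  | lit _ => True
  | Get A e1 => reads w s e1 /\ s A (eval s e1) < 2 ^ w
  | Bin _ e1 e2 => reads w s e1 /\ reads w s e2
  end.

Lemma bits_le k w : 0 < w -> k < 2 ^ w -> bits k <= w.
Proof.
case: k => [|k] w0 h; first by rewrite /bits trunc_log0.
rewrite /bits; have := trunc_logP (isT : 1 < 2) (isT : 0 < k.+1) => h2.
by rewrite -(ltn_exp2l _ _ (isT : 1 < 2)); apply: leq_ltn_trans h2 h.
Qed.

Lemma esize_gt0 e : 0 < esize e. Proof. by case: e. Qed.

(** The bit length of a sum or product is at most the sum of the bit lengths, plus one for a carry;
    truncated subtraction and division never exceed the left operand. *)
Lemma reads_eval w s e : 0 < w -> reads w s e -> eval s e < 2 ^ (esize e * w).
Proof.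
move=> w0; elim: e => [k|A e1 IH|o e1 IH1 e2 IH2] /=.
- move=> _; apply: leq_trans (ltn_expl k (isT : 1 < 2)) _.
  by rewrite leq_exp2l //; nia.
- by move=> [_ h]; apply: leq_trans h _; rewrite leq_exp2l //; nia.
move=> [/IH1 h1 /IH2 h2] {IH1 IH2}.
have g1 := esize_gt0 e1; have g2 := esize_gt0 e2.
set x := eval s e1 in h1 *; set y := eval s e2 in h2 *.
have e12 : 2 ^ (esize e1 * w) * 2 ^ (esize e2 * w) * 2 <=
           2 ^ ((esize e1 + esize e2).+1 * w).
  by rewrite -expnD -expnSr leq_exp2l //; nia.
apply: leq_trans e12.
have p1 : 0 < 2 ^ (esize e1 * w) by rewrite expn_gt0.
have p2 : 0 < 2 ^ (esize e2 * w) by rewrite expn_gt0.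
case: o => /=; [nia | nia | nia |].
by apply: leq_ltn_trans (leq_div _ _) _; nia.
Qed.

(** Quadratic in [esize e]: each node of the expression handles values of at most [esize e * w]
    bits. *)
Lemma reads_cost w s e : 0 < w -> reads w s e -> cost s e <= esize e ^ 2 * w.
Proof.
move=> w0; elim: e => [k|A e1 IH|o e1 IH1 e2 IH2] /=.
- move=> h; have := reads_eval w0 (h : reads w s (lit k)).
  by move/bits_le => /= h1; apply: leq_trans (h1 _) _; nia.
- move=> [r1 h]; have {}IH := IH r1.
  have b1 := bits_le _ (reads_eval w0 r1); have b2 := bits_le w0 h.
  by have g1 := esize_gt0 e1; have {}b1 := b1 ltac:(nia); nia.
move=> [r1 r2]; have {}IH1 := IH1 r1; have {}IH2 := IH2 r2.
have g1 := esize_gt0 e1; have g2 := esize_gt0 e2.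
have b1 := bits_le _ (reads_eval w0 r1); have {}b1 := b1 ltac:(nia).
have b2 := bits_le _ (reads_eval w0 r2); have {}b2 := b2 ltac:(nia).
nia.
Qed.

Lemma reads_bits w s e : 0 < w -> reads w s e -> bits (eval s e) <= esize e * w.
Proof.
move=> w0 /(reads_eval w0) h; apply: bits_le => //.
by have := esize_gt0 e; nia.
Qed.

Fixpoint csize (c : cmd) : nat :=
  match c with
  | Skip => 1
  | Assign _ e1 e2 => (esize e1 + esize e2) ^ 2
  | Seq p q => csize p + csize q
  | If e p q => (esize e).+1 ^ 2 + csize p + csize q
  | While e p => 0
  end.

(** The time bound of [lin] is meant for loop-free programs all of whose memory
   accesses return values of at most [w] bits. *)
Definition lin w c s Q := runs c s (csize c * w) Q.

Lemma lin_assign w s A e1 e2 (Q : store -> Prop) :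
  0 < w -> reads w s e1 -> reads w s e2 ->
  Q (update s A (eval s e1) (eval s e2)) -> lin w (Assign A e1 e2) s Q.
Proof.
move=> w0 r1 r2 q; do 2 eexists; split; [exact: ExecAssign | | exact: q].
have := reads_cost w0 r1; have := reads_cost w0 r2.
have := reads_bits w0 r1; have := reads_bits w0 r2.
have := esize_gt0 e1; have := esize_gt0 e2.
rewrite [csize _]/=; nia.
Qed.

Lemma lin_seq w p q s Q :
  lin w p s (fun s' => lin w q s' Q) -> lin w (Seq p q) s Q.
Proof. by move=> h; rewrite /lin /= mulnDl; apply: runs_seq. Qed.

Lemma runs_if w e p q s t Q :
  0 < w -> reads w s e ->
  (eval s e != 0 -> runs p s t Q) -> (eval s e = 0 -> runs q s t Q) ->
  runs (If e p q) s ((esize e).+1 ^ 2 * w + t) Q.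
Proof.
move=> w0 r hp hq; have hc := reads_cost w0 r; have hb := reads_bits w0 r.
case: (eqVneq (eval s e) 0) => [e0|ne0].
  have [t' [s' [ex le q']]] := hq e0.
  exists (cost s e + bits (eval s e) + t'), s'; split=> //.
    exact: ExecIfFalse.
  by apply: leq_add => //; nia.
have [t' [s' [ex le q']]] := hp ne0.
exists (cost s e + bits (eval s e) + t'), s'; split=> //.
  exact: ExecIfTrue.
by apply: leq_add => //; nia.
Qed.

Lemma lin_if w e p q s Q :
  0 < w -> reads w s e ->
  (eval s e != 0 -> lin w p s Q) -> (eval s e = 0 -> lin w q s Q) ->
  lin w (If e p q) s Q.
Proof.
move=> w0 r hp hq; rewrite /lin /= -addnA mulnDl.
apply: runs_if => // h.
  by apply: runs_weaken (hp h) => //; rewrite leq_mul2r leq_addr orbT.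
by apply: runs_weaken (hq h) => //; rewrite leq_mul2r leq_addl orbT.
Qed.

Lemma lin_skip w s (Q : store -> Prop) : 0 < w -> Q s -> lin w Skip s Q.
Proof. by move=> w0 q; exists 1, s; split=> //; [exact: ExecSkip | rewrite mul1n]. Qed.

(** The guard [e - x] is truncated, hence nonzero exactly while [x < e]. The bound [e] is evaluated
    again at every pass. *)
Definition For x e c :=
  Seq (set_var x (lit 0))
      (While (Bin Sub e (var x)) (Seq c (set_var x (Bin Add (var x) (lit 1))))).

Definition forsize e := (esize e + 10) ^ 2.

(** The budget [tb i] may vary from pass to pass; tree nodes of very different sizes are charged
    this way. The invariant is stated after the counter has been advanced. *)
Lemma runs_for w n (I : nat -> store -> Prop) (tb : nat -> nat) x e c s
    (Q : store -> Prop) :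
  0 < w -> n < 2 ^ w -> x \notin mods c ->
  (forall s', agree (x :: mods c) s s' -> eval s' e = n /\ reads w s' e) ->
  I 0 (update s x 0 0) ->
  (forall i s', i < n -> agree (x :: mods c) s s' -> s' x 0 = i -> I i s' ->
     runs c s' (tb i)
       (fun s'' => agree (mods c) s' s'' -> I i.+1 (update s'' x 0 i.+1))) ->
  (forall s', agree (x :: mods c) s s' -> I n s' -> Q s') ->
  runs (For x e c) s (\sum_(0 <= i < n) tb i + n.+1 * (forsize e * w)) Q.
Proof.
move=> w0 ltn xc he I0 step post; set ms := x :: mods c in he step post *.
pose cw := Seq c (set_var x (Bin Add (var x) (lit 1))).
(* Induction on the number [k] of passes still to come. *)
have loop k i s' : i + k = n -> agree ms s s' -> s' x 0 = i -> I i s' ->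
  runs (While (Bin Sub e (var x)) cw) s'
    (\sum_(i <= j < n) tb j + k.+1 * ((esize e + 8) ^ 2 * w)) Q.
  elim: k i s' => [|k IH] i s' ik ag xi Ii.
    have [ee re] := he _ ag.
    have rS : reads w s' (Bin Sub e (var x)) by rewrite /= xi; do !split=> //; lia.
    exists (cost s' (Bin Sub e (var x)) + bits (eval s' (Bin Sub e (var x)))), s'.
    split; first by apply: ExecWhileFalse; rewrite /= ee xi; lia.
      have := reads_cost w0 rS; have := reads_bits w0 rS.
      rewrite [esize _]/= => h1 h2; apply: leq_trans (leq_add h2 h1) _.
      by have := esize_gt0 e; nia.
    by apply: post; rewrite -?ik ?addn0.
  have [ee re] := he _ ag.
  have rS : reads w s' (Bin Sub e (var x)) by rewrite /= xi; do !split=> //; lia.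
  have lin_ : i < n by lia.
  have [t1 [s1 [ex1 le1 q1]]] := step i s' lin_ ag xi Ii.
  have ag1 := exec_agree ex1.
  have x1 : s1 x 0 = i by rewrite ag1.
  have rA : reads w s1 (Bin Add (var x) (lit 1)) by rewrite /= x1; do !split=> //; lia.
  have ag2 : agree ms s (update s1 x 0 i.+1).
    apply: (agree_trans ag); apply: (@agree_trans _ _ s1).
      by apply: agree_sub ag1 => y; rewrite inE => ->; rewrite orbT.
    by apply: agree_update; rewrite inE eqxx.
  have [||||t2 [s2 [ex2 le2 q2]]] := IH i.+1 (update s1 x 0 i.+1) => //.
  - lia.
  - by rewrite updateE !eqxx.
  - exact: q1 ag1.
  eexists; exists s2; split; last exact: q2.
    apply: ExecWhileTrue; last exact: ex2; first by rewrite /= ee xi; lia.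
    apply: ExecSeq ex1 _.
    have -> : update s1 x 0 i.+1 =
      update s1 x (eval s1 (lit 0)) (eval s1 (Bin Add (var x) (lit 1))).
      by rewrite /= x1 addn1.
    exact: ExecAssign.
  have := reads_cost w0 rS; have := reads_bits w0 rS.
  have := reads_cost w0 rA; have := reads_bits w0 rA.
  have r0 : reads w s1 (lit 0) by [].
  have := reads_cost w0 r0; have := reads_bits w0 r0.
  rewrite (big_ltn lin_); move: le1 le2 (esize_gt0 e).
  set S := \sum_(_ <= _ < _) _.
  move: (cost _ _) (cost _ _) (cost _ _) (bits _) (bits _) (bits _).
  by rewrite /=; clear; move=> *; nia.
apply: (@runs_weaken _ _ (16 * w + (\sum_(0 <= i < n) tb i +
  n.+1 * ((esize e + 8) ^ 2 * w))) _ Q).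
- by have := esize_gt0 e; rewrite /forsize; set S := \sum_(_ <= _ < _) _; nia.
- by move=> s' _; apply.
apply: runs_seq; apply: (@runs_weaken _ _ (csize (set_var x (lit 0)) * w)
  _ (fun s' => runs (While (Bin Sub e (var x)) cw) s' (\sum_(0 <= i < n) tb i +
  n.+1 * ((esize e + 8) ^ 2 * w)) Q)); last first.
- apply: lin_assign => //; apply: loop => //.
  + by apply: agree_update; rewrite inE eqxx.
  + by rewrite updateE !eqxx.
- by move=> s' _; apply.
- by rewrite /=; lia.
Qed.

Definition forcost e c := csize c + 2 * forsize e.

Lemma for_lin w n N (I : nat -> store -> Prop) x e c s (Q : store -> Prop) :
  0 < w -> 0 < N -> n <= N -> n < 2 ^ w -> x \notin mods c ->
  (forall s', agree (x :: mods c) s s' -> eval s' e = n /\ reads w s' e) ->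
  I 0 (update s x 0 0) ->
  (forall i s', i < n -> agree (x :: mods c) s s' -> s' x 0 = i -> I i s' ->
     lin w c s'
       (fun s'' => agree (mods c) s' s'' -> I i.+1 (update s'' x 0 i.+1))) ->
  (forall s', agree (x :: mods c) s s' -> I n s' -> Q s') ->
  runs (For x e c) s (forcost e c * (N * w)) Q.
Proof.
move=> w0 N0 nN ltn xc he I0 step post.
apply: runs_weaken (runs_for w0 ltn xc he I0 step post) => //.
rewrite sum_nat_const_nat subn0 /forcost mulnDl leq_add //.
  by rewrite mulnCA leq_mul2l leq_mul2r nN !orbT.
apply: (@leq_trans (2 * N * (forsize e * w))); last by lia.
by rewrite leq_mul2r; apply/orP; right; lia.
Qed.

(** * Separating moduli *)

(** Legendre's formula padded with zero terms, so that several factorials can share one summation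
    range. *)
Lemma logn_fact_wide p k n : prime p -> k <= n ->
  logn p k`! = \sum_(1 <= i < n.+1) k %/ p ^ i.
Proof.
move=> pp kn; rewrite logn_fact // [RHS](@big_cat_nat _ _ _ k.+1 1 n.+1) ?ltnS //=.
rewrite [X in _ = _ + X]big_nat_cond [X in _ = _ + X]big1 ?addn0 //.
move=> i /andP[/andP[h _] _]; apply: divn_small.
by apply: leq_trans h _; apply/ltnW/ltn_expl/prime_gt1.
Qed.

(** By Legendre's formula the exponent of [p] counts carries: each power [p ^ i] contributes at most
    one, and none once [p ^ i] exceeds [n]. *)
Lemma pfactor_bin_le p n k : prime p -> 0 < n -> k <= n -> p ^ logn p 'C(n, k) <= n.
Proof.
move=> pp n0 kn; have p1 := prime_gt1 pp.
apply: leq_trans (trunc_logP p1 n0); rewrite leq_exp2l //.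
have := congr1 (logn p) (bin_fact kn).
rewrite !lognM ?muln_gt0 ?fact_gt0 ?bin_gt0 // !logn_fact // => e.
have e' : logn p 'C(n, k) + (\sum_(1 <= i < n.+1) k %/ p ^ i +
     \sum_(1 <= i < n.+1) (n - k) %/ p ^ i) = \sum_(1 <= i < n.+1) n %/ p ^ i.
  by rewrite -e -!(@logn_fact_wide p _ n) ?logn_fact // leq_subr.
have : \sum_(1 <= i < n.+1) n %/ p ^ i <= \sum_(1 <= i < n.+1) k %/ p ^ i +
     \sum_(1 <= i < n.+1) (n - k) %/ p ^ i + \sum_(1 <= i < n.+1) (p ^ i <= n).
  rewrite -!big_split /= leq_sum // => i _.
  have pi0 : 0 < p ^ i by rewrite expn_gt0 prime_gt0.
  rewrite -{1}(subnKC kn) divnD //.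
  have [h|h] := leqP (p ^ i) n; first by rewrite leq_add2l leq_b1.
  rewrite addn0 [X in _ + X](_ : _ = false :> nat) ?addn0 //.
  apply/eqP; rewrite eqb0 -ltnNge !modn_small; lia.
suff : \sum_(1 <= i < n.+1) (p ^ i <= n) <= trunc_log p n by lia.
have tn : trunc_log p n <= n.
  by apply: ltnW; apply: leq_trans (trunc_logP p1 n0); apply: ltn_expl.
rewrite (@big_cat_nat _ _ _ (trunc_log p n).+1 1 n.+1) ?ltnS //= [X in _ + X]big_nat_cond.
rewrite [X in _ + X]big1 ?addn0 => [|i /andP[/andP[h _] _]].
  apply: leq_trans (_ : \sum_(1 <= i < (trunc_log p n).+1) 1 <= _).
    by apply: leq_sum => i _; apply: leq_b1.
  by rewrite sum_nat_const_nat; lia.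
apply/eqP; rewrite eqb0 -ltnNge; apply: leq_trans (trunc_log_ltn n p1) _.
by rewrite leq_exp2l.
Qed.

(** Every prime power exactly dividing the binomial is at most [n], hence one of the given divisors
    of [d]. *)
Lemma dvdn_bin_lcm n k d : 0 < n -> k <= n ->
  (forall q, 0 < q <= n -> q %| d) -> 'C(n, k) %| d.
Proof.
move=> n0 kn h; have b0 : 0 < 'C(n, k) by rewrite bin_gt0.
apply/(dvdn_partP _ b0) => p.
rewrite mem_primes => /and3P[pp _ _]; rewrite p_part; apply: h.
by rewrite expn_gt0 prime_gt0 //= pfactor_bin_le.
Qed.

(** Pascal's rule and symmetry show that the central binomial at least doubles with each step of
    [m]. *)
Lemma bin_double_ge m : 2 ^ m <= 'C(m.*2, m).
Proof.
elim: m => [|m IH] //; rewrite expnS doubleS binS.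
have -> : 'C(m.*2.+1, m) = 'C(m.*2.+1, m.+1).
  by rewrite -bin_sub; [congr binomial|]; lia.
by rewrite binS; lia.
Qed.

(** Otherwise every [q <= 2M] divides some difference, so ['C(2M, M) >= 2 ^ M] divides the nonzero
    product [D] of all differences, which is at most [2 ^ (size s * Lg)]. *)
Lemma exists_separating_modulus (s : seq nat) p Lg M :
  p < 2 ^ Lg -> {in s, forall p', p' != p /\ p' < 2 ^ Lg} -> size s * Lg < M ->
  exists q, [/\ 0 < q, q <= M.*2 & {in s, forall p', p' != p %[mod q]}].
Proof.
move=> hp hs hM.
(* With truncated subtraction, the sum of the two differences is the absolute difference. *)
pose D := \prod_(p' <- s) ((p - p') + (p' - p)).
have D_gt0 : 0 < D.
  rewrite /D big_seq_cond prodn_cond_gt0 // => i; rewrite andbT => /hs[h _].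
  by lia.
have D_lt : D <= 2 ^ (size s * Lg).
  rewrite /D -sum1_size big_distrl /= expn_sum big_seq_cond [X in _ <= X]big_seq_cond.
  apply: leq_prod => i; rewrite andbT mul1n => /hs[_ h]; lia.
case: (boolP [exists q : 'I_(M.*2), all (fun p' => p' != p %[mod q.+1]) s]).
  move=> /existsP[q /allP h]; exists q.+1; split=> // p' /h //.
rewrite negb_exists => /forallP h; exfalso.
have : 'C(M.*2, M) %| D.
  apply: dvdn_bin_lcm => [||q /andP[q0 qM]]; try lia.
  have qM' : q.-1 < M.*2 by lia.
  have := h (Ordinal qM'); rewrite -has_predC => /hasP[p' p's /=].
  rewrite (prednK q0) negbK => /eqP e.
  rewrite /D (big_rem p') //= dvdn_mulr //.
  have [le|le] := leqP p p'.
    by rewrite (eqP le) add0n -eqn_mod_dvd // e.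
  have -> : p' - p = 0 by lia.
  by rewrite addn0 -eqn_mod_dvd ?(ltnW le) // e.
move/(dvdn_leq D_gt0) => h1; have h2 := bin_double_ge M.
have : 2 ^ (size s * Lg) < 2 ^ M by rewrite ltn_exp2l.
lia.
Qed.

(** * Crowds in a random order *)

Lemma shifted_lt n h (j : 'I_n) :
  (if j < h then if j + h < n then j + h else j
   else if j < h.*2 then j - h else j) < n.
Proof. by case: j => j /= hj; repeat case: ifP => ?; lia. Qed.

(** Exchanges [j] with [j + h] for [j < h]; a position whose partner would fall beyond [n] stays
    fixed. *)
Definition partner n h (j : 'I_n) : 'I_n := Ordinal (shifted_lt h j).

Lemma partnerK n h : involutive (@partner n h).
Proof.
move=> [j hj]; apply: val_inj => /=.
case: (ltnP j h) => ?; [case: (ltnP (j + h) n) => ?|case: (ltnP j h.*2) => ?].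
all: by repeat case: ltnP => ? //; lia.
Qed.

Definition swap n h (T : {set 'I_n}) (j : 'I_n) : 'I_n :=
  if (j \in T) || (partner h j \in T) then partner h j else j.

Lemma swapK n h (T : {set 'I_n}) : involutive (swap h T).
Proof.
move=> j; rewrite {2}/swap; case: ifP => e; rewrite /swap.
  by rewrite partnerK orbC e.
by rewrite e.
Qed.

Definition swap_perm n h (T : {set 'I_n}) : 'S_n := perm (can_inj (swapK h T)).

(** The first condition confines the positions counted by the second to the interval from [h] to
    [2h - 1]. *)
Definition late_crowd n (X : {set 'I_n}) h K (sigma : 'S_n) : bool :=
  [forall p : 'I_n, (sigma p \in X) ==> (h <= p)] &&
  (K <= #|[set p : 'I_n | (sigma p \in X) && (p < h.*2)]|).

(** Exchanging positions [j] and [j + h] for the [j + h] in an arbitrary subset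
   of the crowd gives [2 ^ K] permutations, from which the subset can be read
   off: it consists of the exchanged positions now holding elements of [X] before
   [h]. *)
Lemma card_late_crowd n (X : {set 'I_n}) h K :
  #|[set sigma | late_crowd X h K sigma]| * 2 ^ K <= n`!.
Proof.
pose crowd (sigma : 'S_n) := [set p : 'I_n | (sigma p \in X) && (p < h.*2)].
pose pairs := [set x : 'S_n * {set 'I_n} |
  late_crowd X h K x.1 && (x.2 \subset crowd x.1)].
pose f (x : 'S_n * {set 'I_n}) : 'S_n := (swap_perm h x.2 * x.1)%g.
have fE x j : f x j = x.1 (swap h x.2 j) by rewrite permM permE.
have rec x : x \in pairs ->
    x.2 = [set j : 'I_n | (h <= j < h.*2) && (f x (partner h j) \in X)].
  case: x => sigma T; rewrite inE /= => /andP[/andP[/forallP late _] /subsetP sub].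
  have TE (j : 'I_n) : j \in T -> h <= j < h.*2.
    by move/sub; rewrite inE => /andP[Xj ->]; rewrite (implyP (late j)).
  apply/setP => j; rewrite inE fE /=.
  case: (boolP (h <= j < h.*2)) => [hj|]; last first.
    by apply: contraNF => /TE.
  rewrite /swap partnerK.
  case: (boolP (j \in T)) => [jT|njT].
    by rewrite orbT; move/sub: jT; rewrite inE => /andP[->].
  have lt_h : partner h j < h.
    by move: hj; rewrite /partner /=; repeat case: ifP => ?; lia.
  rewrite orbF; case: ifP => [/TE|_]; first by rewrite leqNgt lt_h.
  apply/esym/negP => /(implyP (late _)); by rewrite leqNgt lt_h.
have finj : {in pairs &, injective f}.
  move=> x y px py fxy; have e2 : x.2 = y.2 by rewrite (rec _ px) (rec _ py) fxy.
  case: x y px py fxy e2 => [sx Tx] [sy Ty] /= _ _ fxy e2; congr (_, _) => //.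
  apply/permP => j; have := congr1 (fun g : 'S_n => g (swap h Tx j)) fxy.
  by rewrite !fE /= -e2 swapK.
rewrite -card_Sn -[X in _ <= X]cardsT.
apply: leq_trans (subset_leq_card (subsetT (f @: pairs))).
rewrite (card_in_imset finj).
have <- : \sum_(s | late_crowd X h K s) \sum_(T : {set 'I_n} | T \subset crowd s) 1
    = #|pairs|.
  by rewrite pair_big_dep -sum1_card; apply: eq_bigl => x; rewrite inE.
rewrite -sum_nat_const.
rewrite (eq_bigl (late_crowd X h K)) => [|s]; last by rewrite inE.
apply: leq_sum => s /andP[_ hK].
rewrite (eq_bigl (mem (powerset (crowd s)))) => [|T]; last by rewrite /= powersetE.
by rewrite sum1_card card_powerset leq_exp2l //.
Qed.

(** * Numbers written in a large base *)

Lemma big_nat_shift (P : pred nat) (F : nat -> nat) a b :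
  \sum_(a <= i < b | P i) F i = \sum_(0 <= i < b - a | P (i + a)) F (i + a).
Proof. by rewrite -{1}(add0n a) big_addn. Qed.

Definition block (f : nat -> nat) B h v :=
  \sum_(0 <= i < 2 ^ h) f (v * 2 ^ h + i) * B ^ i.

Lemma block0 f B v : block f B 0 v = f v.
Proof. by rewrite /block expn0 big_nat1 muln1 addn0 muln1. Qed.

Lemma blockS f B h v :
  block f B h.+1 v =
  block f B h v.*2 + block f B h v.*2.+1 * B ^ (2 ^ h).
Proof.
rewrite /block (@big_cat_nat _ _ _ (2 ^ h) 0 (2 ^ h.+1)) //= ?leq_exp2l //.
congr (_ + _).
  by apply: eq_bigr => i _; congr (f _ * _); rewrite expnS; lia.
rewrite big_nat_shift big_distrl /=.
have -> : 2 ^ h.+1 - 2 ^ h = 2 ^ h by rewrite expnS; lia.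
apply: eq_bigr => i _; rewrite expnD mulnA; congr (f _ * _ * _).
by rewrite expnS; lia.
Qed.

Lemma block_lt f B h v : 0 < B -> (forall a, f a < B) -> block f B h v < B ^ (2 ^ h).
Proof.
move=> B0 hf; elim: h v => [|h IH] v; first by rewrite block0 expn0 expn1.
have e : B ^ 2 ^ h.+1 = B ^ 2 ^ h * B ^ 2 ^ h by rewrite expnS mul2n -addnn expnD.
rewrite blockS e.
have := IH v.*2; have := IH v.*2.+1; nia.
Qed.

Lemma block_div f B h v : 0 < B -> (forall a, f a < B) ->
  block f B h.+1 v %/ B ^ (2 ^ h) = block f B h v.*2.+1.
Proof.
move=> B0 hf; rewrite blockS divnDMl ?expn_gt0 ?B0 //.
by rewrite divn_small ?add0n // block_lt.
Qed.

(** Pairs are grouped by [k + j]; the vanishing hypothesis removes every power of [B] from [B ^ N]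
    on. *)
Lemma kronecker_mul (x y : nat -> nat) B N :
  (forall k j, N <= k + j -> x k * y j = 0) ->
  (\sum_(0 <= k < N) x k * B ^ k) * (\sum_(0 <= j < N) y j * B ^ j) =
  \sum_(0 <= i < N) (\sum_(0 <= k < N | k <= i) x k * y (i - k)) * B ^ i.
Proof.
move=> xy0; rewrite big_distrl /=.
under [RHS]eq_bigr do rewrite big_distrl /=.
rewrite (exchange_big_dep_nat predT) //= big_nat_cond [RHS]big_nat_cond.
apply: eq_bigr => k; rewrite andbT => /andP[_ kN].
rewrite big_distrr /=.
rewrite [RHS](@big_cat_nat _ _ _ k 0 N) //=; last exact: ltnW.
rewrite [X in _ = X + _]big_nat_cond [X in _ = X + _]big1 ?add0n; last by move=> i; lia.
rewrite [RHS]big_nat_shift.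
rewrite [LHS](@big_cat_nat _ _ _ (N - k) 0 N) //=; last exact: leq_subr.
rewrite [X in _ + X]big_nat_cond [X in _ + X]big1 ?addn0; last first.
  move=> i /andP[/andP[h _] _]; rewrite mulnACA xy0 //; lia.
rewrite [RHS]big_mkcond /=; apply: eq_bigr => i _.
by rewrite leq_addl addnK mulnACA -expnD addnC.
Qed.

(** The depth of [v] in heap numbering is [trunc_log 2 v]; the leaves have depth [Lg]. *)
Definition ht Lg v := Lg - trunc_log 2 v.

Lemma ht_leaf Lg v : 2 ^ Lg <= v -> ht Lg v = 0.
Proof.
move=> h; rewrite /ht; apply/eqP; rewrite subn_eq0.
by apply: trunc_log_max.
Qed.

Lemma ht_double Lg v b : 0 < v -> v < 2 ^ Lg -> (ht Lg (v.*2 + (b : bool))).+1 = ht Lg v.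
Proof.
move=> v0 vN; rewrite /ht.
have /= h := trunc_log_bounds (isT : 1 < 2) v0.
have -> : trunc_log 2 (v.*2 + b) = (trunc_log 2 v).+1.
  by apply: trunc_log_eq => //; move: h => /=; rewrite !expnS; case: b => /=; lia.
suff : trunc_log 2 v < Lg by lia.
by rewrite -(ltn_exp2l _ _ (isT : 1 < 2)); lia.
Qed.

Lemma ht1 Lg : ht Lg 1 = Lg. Proof. by rewrite /ht trunc_log1 subn0. Qed.

(** Each of the [Lg] inner levels covers all [2 ^ Lg] leaves once. This controls the total cost of
    the tree passes. *)
Lemma sum_ht Lg : \sum_(1 <= v < 2 ^ Lg) 2 ^ ht Lg v = Lg * 2 ^ Lg.
Proof.
have key k : k <= Lg -> \sum_(1 <= v < 2 ^ k) 2 ^ ht Lg v = k * 2 ^ Lg.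
  elim: k => [|k IH] hk; first by rewrite expn0 big_geq.
  rewrite (@big_cat_nat _ _ _ (2 ^ k)) ?expn_gt0 ?leq_exp2l //= IH ?(ltnW hk) //.
  rewrite (eq_big_nat _ _ (F2 := fun _ => 2 ^ (Lg - k))) => [|v hv]; last first.
    by rewrite /ht (@trunc_log_eq _ k v).
  rewrite sum_nat_const_nat expnS mul2n -addnn addnK -expnD subnKC ?(ltnW hk) //.
  by rewrite mulSn addnC.
exact: key.
Qed.

(** * The program *)

(** A scalar lives in cell 0 of an array of its own.  A tree has its root in cell
   1, the children of [v] in cells [2 * v] and [2 * v + 1], and the leaves from cell
   [SIZE] on; [SIZE] is the power [2 ^ LOG]. *)
Notation LENGTHS := 0 (only parsing).
Notation INA := 1 (only parsing).
Notation INB := 2 (only parsing).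
Notation ORDER := 3 (only parsing).
Notation OUT := 4 (only parsing).
Notation SIZE := 5 (only parsing).
Notation LOG := 6 (only parsing).
Notation POW := 7 (only parsing).
Notation CROWD := 8 (only parsing).
Notation MODULI := 9 (only parsing).
Notation BEST := 10 (only parsing).
Notation FLAG := 11 (only parsing).
Notation TEST := 12 (only parsing).
Notation PREFIX := 13 (only parsing).
Notation MODULUS := 14 (only parsing).
Notation RESIDUE := 15 (only parsing).
Notation IDX := 16 (only parsing).
Notation TREEA := 17 (only parsing).
Notation TREEB := 18 (only parsing).
Notation TREEP := 19 (only parsing).
Notation TREEC := 20 (only parsing).
Notation NODE := 21 (only parsing).
Notation COUNT := 22 (only parsing).
Notation CTR := 23 (only parsing).

(** Comparisons by truncated subtraction; their values 0 and 1 serve as factors in place of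
    branches. *)
Definition less e f : expr := (lit 1 - (e + lit 1 - f))%P.
Definition equal e f : expr := (lit 1 - ((e - f) + (f - e)))%P.
Definition modulo e f : expr := (e - e / f * f)%P.

Definition sg_idx := ORDER@[var IDX].

(** The base placed in [TREEP] is [SIZE ^ 3], larger than any digit of the product ([digit_lt]), so
    no carries occur. *)
Definition fill_leaves : cmd :=
  Assign TREEA (var SIZE + var IDX)%P (lit 0);;
  Assign TREEB (var SIZE + var IDX)%P (INB@[var IDX]);;
  Assign TREEP (var SIZE + var IDX)%P (var SIZE * var SIZE * var SIZE)%P.

(** The loop runs over positions and scatters the weight of each to the leaf of the element standing
    there. *)
Definition fill_weight : cmd :=
  Assign TREEA (var SIZE + sg_idx)%P
    (TREEA@[var SIZE + sg_idx] +
     less (var IDX) (var PREFIX) *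
     equal (modulo (var IDX) (var MODULUS)) (var RESIDUE) *
     INA@[sg_idx] * (lit 1 + var SIZE * var IDX))%P.

Definition fill : cmd :=
  For IDX (var SIZE) fill_leaves;;
  For IDX LENGTHS@[lit 0] fill_weight.

Definition left_child : expr := (lit 2 * var NODE)%P.
Definition right_child : expr := (lit 2 * var NODE + lit 1)%P.

Definition merge_into A : cmd :=
  Assign A (var NODE) (A@[left_child] + A@[right_child] * TREEP@[left_child])%P.

(** Nodes are visited from [SIZE - 1] down to 1, children before parents; [split_node] goes the
    other way. [TREEP] keeps the power of the base by which the right child is shifted. *)
Definition merge_node : cmd :=
  set_var NODE (var SIZE - lit 1 - var IDX)%P;;
  merge_into TREEA;;
  merge_into TREEB;;
  Assign TREEP (var NODE) (TREEP@[left_child] * TREEP@[right_child])%P.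

Definition split_node : cmd :=
  set_var NODE (var IDX + lit 1)%P;;
  Assign TREEC right_child (TREEC@[var NODE] / TREEP@[left_child])%P;;
  Assign TREEC left_child
    (TREEC@[var NODE] - TREEC@[right_child] * TREEP@[left_child])%P.

Definition merge_tree : cmd := For IDX (var SIZE - lit 1)%P merge_node.
Definition multiply : cmd := Assign TREEC (lit 1) (TREEA@[lit 1] * TREEB@[lit 1])%P.
Definition split_tree : cmd := For IDX (var SIZE - lit 1)%P split_node.

Definition convolve : cmd := fill;; merge_tree;; multiply;; split_tree.

(** * Digits of the weighted convolution: numbers and sums of witness positions *)

Section Program.

Variables (n m Lg : nat) (av bv : nat -> bool) (sg : nat -> nat).
Hypotheses (n0 : 0 < n) (m0 : 0 < m) (nmN : n + m <= 2 ^ Lg) (Lg0 : 0 < Lg).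
Hypothesis sgn : forall p, sg p < n.
Hypothesis bvm : forall j, bv j -> j < m.

Local Notation N := (2 ^ Lg).

(** Witnesses are named by their position [p] in the order; the element itself is [sg p]. *)
Definition wit i p := [&& p < n, sg p <= i, av (sg p) & bv (i - sg p)].

Definition rank_count (act : pred nat) i := \sum_(0 <= p < n) (act p && wit i p).
Definition rank_sum (act : pred nat) i := \sum_(0 <= p < n) (act p && wit i p) * p.

(** The bound [u] is the number of positions already scattered, so that partial weights form a loop
    invariant. *)
Definition weight (act : pred nat) u k :=
  \sum_(0 <= p < u) [&& act p, av (sg p) & sg p == k] * (1 + N * p).

Definition digit act i := \sum_(0 <= k < N | k <= i) weight act n k * bv (i - k).

Lemma nN : n < N. Proof. lia. Qed.

Lemma cube_gt : n * (N * n) < N ^ 3.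
Proof.
have := nN => h; rewrite mulnCA !expnS expn0 muln1 ltn_pmul2l ?expn_gt0 //.
by apply: ltn_mul.
Qed.

(** After exchanging the sums, position [p] contributes only at [k = sg p], and its weight
    [1 + N * p] splits into a unit of the count and a term of the sum. *)
Lemma digitE act i : digit act i = rank_count act i + N * rank_sum act i.
Proof.
rewrite /digit /weight /rank_count /rank_sum big_distrr -big_split /=.
under eq_bigr do rewrite big_distrl /=.
rewrite exchange_big_nat /= big_nat_cond [RHS]big_nat_cond; apply: eq_bigr => p.
rewrite andbT => /andP[_ pn]; rewrite /wit pn /=.
have sN : sg p < N by apply: ltn_trans (sgn p) nN.
case: (leqP (sg p) i) => hi; last first.
  rewrite /= andbF big_nat_cond big1 ?mul0n ?muln0 // => k /andP[_ ki].
  by rewrite (_ : sg p == k = false) ?andbF //; lia.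
rewrite big_mkcond (@big_cat_nat _ _ _ (sg p) 0 N) //=; last exact: ltnW.
rewrite (big_ltn sN) /= hi eqxx.
rewrite [X in X + _]big_nat_cond [X in X + _]big1 ?add0n; last first.
  move=> k /andP[/andP[_ kp] _]; rewrite (_ : sg p == k = false) ?andbF; last lia.
  by case: ifP.
rewrite [X in _ + X]big_nat_cond [X in _ + X]big1 ?addn0; last first.
  move=> k /andP[/andP[kp _] _]; rewrite (_ : sg p == k = false) ?andbF; last lia.
  by case: ifP.
by case: (act p); case: (av _); case: (bv _) => //=; lia.
Qed.

Lemma count_lt act i : rank_count act i < N.
Proof.
apply: leq_ltn_trans nN; rewrite -[n in _ <= n]subn0 -[X in _ <= X]muln1 -sum_nat_const_nat.
by apply: leq_sum => p _; apply: leq_b1.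
Qed.

Lemma weight_lt act u k : u <= n -> weight act u k < N ^ 3.
Proof.
move=> un; apply: (@leq_ltn_trans (\sum_(0 <= p < u) N * n)).
  rewrite /weight big_nat_cond [X in _ <= X]big_nat_cond; apply: leq_sum => p.
  rewrite andbT => /andP[_ pu]; have := nN.
  by case: [&& _, _ & _] => //=; nia.
rewrite sum_nat_const_nat subn0; have := nN => h.
have : u * (N * n) <= n * (N * n) by rewrite leq_mul2r un orbT.
move/leq_ltn_trans; apply; exact: cube_gt.
Qed.

Lemma digit_lt act i : digit act i < N ^ 3.
Proof.
rewrite digitE; apply: (@leq_ltn_trans (\sum_(0 <= p < n) N * n)).
  rewrite /rank_count /rank_sum big_distrr -big_split /=.
  rewrite big_nat_cond [X in _ <= X]big_nat_cond; apply: leq_sum => p.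
  rewrite andbT => /andP[_ pu]; have := nN.
  by case: (_ && _) => //=; nia.
rewrite sum_nat_const_nat subn0; exact: cube_gt.
Qed.

(** The count is below [N], so it is the low digit in base [N] and the sum of positions is the
    rest. *)
Lemma digit_mod act i : digit act i %% N = rank_count act i.
Proof. by rewrite digitE mulnC addnC modnMDl modn_small // count_lt. Qed.

Lemma digit_div act i : digit act i %/ N = rank_sum act i.
Proof.
by rewrite digitE mulnC addnC divnMDl ?expn_gt0 // divn_small ?addn0 // count_lt.
Qed.

Lemma weight_ge act u k : n <= k -> weight act u k = 0.
Proof.
move=> nk; rewrite /weight big1 // => p _.
by have := sgn p => h; rewrite (_ : sg p == k = false) ?andbF //; lia.
Qed.

(** From [n + m <= N]; this is the vanishing hypothesis of [kronecker_mul]. *)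
Lemma weight_bv act k j : N <= k + j -> weight act n k * bv j = 0.
Proof.
move=> h; case: (leqP n k) => [nk|kn]; first by rewrite weight_ge.
case: (boolP (bv j)) => [/bvm|]; last by rewrite muln0.
lia.
Qed.

Lemma weightS act u k : weight act u.+1 k =
  weight act u k + [&& act u, av (sg u) & sg u == k] * (1 + N * u).
Proof. by rewrite /weight big_nat_recr. Qed.

Lemma count1P act i : rank_count act i = 1 ->
  act (rank_sum act i) /\ wit i (rank_sum act i).
Proof.
move=> h; pose s := [seq p <- index_iota 0 n | act p && wit i p].
have ss : size s = 1.
  rewrite size_filter -h /rank_count -sum1_count big_mkcond /=.
  by apply: eq_bigr => p _; case: ifP.
have : rank_sum act i = \sum_(p <- s) p.
  rewrite /rank_sum big_filter [RHS]big_mkcond /=; apply: eq_bigr => p _.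
  by case: ifP => _; rewrite ?mul1n.
move: ss; case sp : s => [|p [|]] //= _ ->.
rewrite big_seq1; have : p \in s by rewrite sp inE.
by rewrite mem_filter => /andP[/andP[]].
Qed.

Lemma count_isolated (act : pred nat) i p : act p -> wit i p ->
  (forall p', act p' -> wit i p' -> p' = p) -> rank_count act i = 1 /\ rank_sum act i = p.
Proof.
move=> ap wp uni; have pn : p < n by case/and4P: wp.
have only p' : (act p' && wit i p') = (p' == p).
  by apply/andP/eqP => [[]|-> //]; apply: uni.
have sum_only F : \sum_(0 <= p' < n) (p' == p) * F p' = F p.
  rewrite big_mkord (bigD1 (Ordinal pn)) //= eqxx mul1n big1 ?addn0 // => j.
  by rewrite -val_eqE /= => /negbTE ->.
split; rewrite /rank_count /rank_sum.
  rewrite -(sum_only (fun _ => 1)).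
  by apply: eq_bigr => p' _; rewrite only muln1.
by rewrite -(sum_only id); apply: eq_bigr => p' _; rewrite only.
Qed.

(** * Word size and the data that all phases preserve *)

Local Notation w := (10 * Lg).
(** This is [2M] for [M = 2 * Lg ^ 2], the bound of [exists_separating_modulus] for fewer than
    [2 * Lg] competitors of [Lg] bits. *)
Local Notation Q := (4 * Lg ^ 2).

Lemma w_gt0 : 0 < w. Proof. lia. Qed.
Hint Resolve w_gt0 : core.

Record ctx (s : store) : Prop := Ctx {
  ctx_n : s LENGTHS 0 = n;
  ctx_m : s LENGTHS 1 = m;
  ctx_a : forall k, s INA k = av k;
  ctx_b : forall k, s INB k = bv k;
  ctx_sg : forall p, s ORDER p = sg p;
  ctx_N : s SIZE 0 = N;
  ctx_Lg : s LOG 0 = Lg;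
  ctx_pow : forall j, j <= Lg -> s POW j = 2 ^ j;
  ctx_K : s CROWD 0 = 2 * Lg;
  ctx_Q : s MODULI 0 = Q }.

(** The side condition on [ms] is decided by computation, so [isT] discharges it for each concrete
    program. *)
Lemma ctx_agree ms s s' :
  agree ms s s' -> ctx s ->
  all [predC ms] [:: LENGTHS; INA; INB; ORDER; SIZE; LOG; POW; CROWD; MODULI] ->
  ctx s'.
Proof.
move=> ag c /= /and5P[? ? ? ? /and5P[? ? ? ? /andP[? _]]].
split=> *; rewrite ag //; by [apply: ctx_n | apply: ctx_m | apply: ctx_a
  | apply: ctx_b | apply: ctx_sg | apply: ctx_N | apply: ctx_Lg | apply: ctx_pow
  | apply: ctx_K | apply: ctx_Q].
Qed.

Lemma lt_w x : x <= N ^ 3 -> x < 2 ^ w.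
Proof.
move=> h; apply: leq_ltn_trans h _; rewrite -expnM ltn_exp2l //; lia.
Qed.

Lemma N_le_cube : N <= N ^ 3.
Proof. by rewrite -{1}(expn1 N) leq_pexp2l // expn_gt0. Qed.

Lemma N_gt0 : 0 < N. Proof. by rewrite expn_gt0. Qed.

Lemma lt_wN x : x <= N -> x < 2 ^ w.
Proof. by move=> h; apply: lt_w; apply: leq_trans h N_le_cube. Qed.

Lemma Q_lt : Q < 2 ^ w.
Proof.
have h : Lg < 2 ^ Lg by apply: ltn_expl.
apply: (@leq_trans (2 ^ (2 + Lg + Lg))); last by rewrite leq_exp2l //; lia.
rewrite !expnD expnS expn1 mulnA -[2 ^ 2]/4; nia.
Qed.

Definition act l q c : pred nat := fun p => (p < 2 ^ l) && (p %% q == c).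

Lemma eval_less s e f : eval s (less e f) = (eval s e < eval s f).
Proof. by rewrite /=; case: ltnP; lia. Qed.

Lemma eval_equal s e f : eval s (equal e f) = (eval s e == eval s f).
Proof. by rewrite /=; case: eqP; lia. Qed.

Lemma eval_modulo s e f : eval s (modulo e f) = eval s e %% eval s f.
Proof. by rewrite /= {1}(divn_eq (eval s e) (eval s f)) addnC addnK. Qed.

(** The first loop clears the leaves of [TREEA]; the second maintains the partial weights of the
    positions seen so far. *)
Lemma fill_spec l q c s : ctx s -> l <= Lg -> 0 < q <= Q -> c <= Q ->
  s PREFIX 0 = 2 ^ l -> s MODULUS 0 = q -> s RESIDUE 0 = c ->
  runs fill s ((forcost (var SIZE) fill_leaves +
                forcost LENGTHS@[lit 0] fill_weight) * (N * w))
   (fun s' => forall k, k < N ->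
     [/\ s' TREEA (N + k) = weight (act l q c) n k,
         s' TREEB (N + k) = bv k & s' TREEP (N + k) = N ^ 3]).
Proof.
move=> cs lL qQ cQ sH sq sc; rewrite mulnDl.
apply: runs_seq.
pose I1 i (s' : store) := forall k, k < i ->
     [/\ s' TREEA (N + k) = 0, s' TREEB (N + k) = bv k & s' TREEP (N + k) = N ^ 3].
apply: (@for_lin w N _ I1) => //; rewrite ?N_gt0 ?lt_wN //.
- by move=> s' ag; have c' := ctx_agree ag cs isT; rewrite /= (ctx_N c') lt_wN.
- move=> i s' hi ag si Ii; have c' := ctx_agree ag cs isT.
  have hN := lt_wN (leqnn N); have hi' := lt_wN (ltnW hi).
  apply: lin_seq; apply: lin_assign => //=; rewrite ?(ctx_N c') ?si //.
  apply: lin_seq; apply: lin_assign => //=; rewrite !updateE /= ?(ctx_N c') ?si ?(ctx_b c') //.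
    by do !split => //; rewrite lt_wN //; apply: leq_trans (leq_b1 _) N_gt0.
  apply: lin_assign => //=; rewrite ?updateE /= ?(ctx_N c') ?si //.
  move=> _ k; rewrite ltnS leq_eqVlt => /predU1P[->|ki].
    rewrite !updateE /= !eqxx; split=> //; rewrite !expnS expn0; lia.
  have [e1 e2 e3] := Ii k ki.
  rewrite !updateE /= (_ : (N + k == N + i) = false) ?e1 ?e2 ?e3 //; lia.
- move=> s1 ag1 I1N; have c1 := ctx_agree ag1 cs isT.
  have ag1' A : A \notin [:: IDX; TREEA; TREEB; TREEP] -> s1 A 0 = s A 0.
    by move=> h; apply: ag1; move: h; rewrite !inE.
  pose I2 u (s' : store) := forall k, k < N ->
     [/\ s' TREEA (N + k) = weight (act l q c) u k,
         s' TREEB (N + k) = bv k & s' TREEP (N + k) = N ^ 3].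
  apply: (@for_lin w n _ I2) => //; rewrite ?N_gt0 //; try by [lia | apply: lt_wN; lia].
  + move=> s' ag; have c' := ctx_agree ag c1 isT.
    by rewrite /= (ctx_n c'); do !split => //; apply: lt_wN; lia.
  + move=> k kN; have [e1 e2 e3] := I1N k kN; rewrite !updateE /=; split=> //.
    by rewrite e1 /weight big_geq.
  + move=> u s' hu ag su Iu; have c' := ctx_agree ag c1 isT.
    have sgN : sg u < N by have := sgn u; lia.
    have [e1 e2 e3] := Iu _ sgN.
    have sH' : s' PREFIX 0 = 2 ^ l by rewrite ag // ag1'.
    have sq' : s' MODULUS 0 = q by rewrite ag // ag1'.
    have sc' : s' RESIDUE 0 = c by rewrite ag // ag1'.
    apply: lin_assign => //.
    * rewrite /= su (ctx_N c') (ctx_sg c').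
      by do !split => //; apply: lt_wN; lia.
    * have hH : 2 ^ l <= N by rewrite leq_exp2l.
      rewrite /= su (ctx_N c') (ctx_sg c') (ctx_a c') e1 sH' sq' sc'.
      have QN : Q < 2 ^ w by exact: Q_lt.
      have wt := ltnW (weight_lt (act l q c) (sg u) (ltnW hu)).
      have := leq_b1 (av (sg u)) => avle.
      do !split => //; try by [apply: lt_wN; lia | apply: lt_w; exact: wt | lia].
    move=> _ k kN; have [f1 f2 f3] := Iu k kN.
    rewrite !updateE [_ == IDX]/= !andFb; split=> //.
    (* The value is restated with [less], [equal] and [modulo] still folded, so that their
       evaluation lemmas apply. *)
    set e := (_ + _ * _)%P.
    have -> : eval s' e = weight (act l q c) u.+1 (sg u).
      rewrite weightS eqxx -e1 -[LHS]/(eval s' TREEA@[var SIZE + sg_idx] +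
        eval s' (less (var IDX) (var PREFIX)) *
        eval s' (equal (modulo (var IDX) (var MODULUS)) (var RESIDUE)) *
        eval s' INA@[sg_idx] * eval s' (lit 1 + var SIZE * var IDX)%P).
      rewrite eval_less eval_equal eval_modulo /=.
      rewrite su (ctx_N c') (ctx_sg c') (ctx_a c') sH' sq' sc'.
      by rewrite /act; case: (_ < _); case: (_ == _); case: (av _).
    rewrite [eval s' (var SIZE + sg_idx)%P]/= su (ctx_N c') (ctx_sg c').
    rewrite (_ : (N + k == N + sg u) = (sg u == k)); last by rewrite eqn_add2l eq_sym.
    rewrite eqxx andTb; case: (sg u =P k) => [->|ne] //.
    by rewrite f1 weightS (introF eqP ne) !andbF addn0.
Qed.

(** * Assembling and taking apart the huge integers *)

Local Notation B := (N ^ 3).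
Local Notation node f v := (block (fun u => f (u - N)) B (ht Lg v) v).
(** A leaf needs [3 * Lg] bits; the fourth [Lg] leaves room for the power of [B] itself and for
    addresses. *)
Local Notation node_bits v := (4 * Lg * 2 ^ ht Lg v).

Lemma B_gt0 : 0 < B. Proof. by rewrite expn_gt0 N_gt0. Qed.

Lemma node_leaf f k : k < N -> node f (N + k) = f k.
Proof. by move=> _; rewrite ht_leaf ?leq_addr // block0 addKn. Qed.

Lemma ht_right v : 0 < v -> v < N -> ht Lg v.*2.+1 = ht Lg v.*2.
Proof.
move=> v0 vN; apply: succn_inj; rewrite -[v.*2.+1]addn1 -{2}[v.*2]addn0.
by rewrite (ht_double true v0 vN) (ht_double false v0 vN).
Qed.

Lemma ht_left v : 0 < v -> v < N -> ht Lg v = (ht Lg v.*2).+1.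
Proof.
by move=> v0 vN; rewrite -(ht_double false v0 vN) addn0.
Qed.

Lemma node_split f v : 0 < v -> v < N ->
  node f v = node f v.*2 + node f v.*2.+1 * B ^ (2 ^ ht Lg v.*2).
Proof.
by move=> v0 vN; rewrite (ht_left v0 vN) blockS (ht_right v0 vN).
Qed.

Lemma lt_node_bits x v : x <= B ^ (2 ^ ht Lg v) -> x < 2 ^ node_bits v.
Proof.
move/leq_ltn_trans; apply; rewrite -!expnM ltn_exp2l //.
by have : 0 < 2 ^ ht Lg v by [rewrite expn_gt0]; nia.
Qed.

Lemma lt_node_bitsN x v : x <= N -> x < 2 ^ node_bits v.
Proof.
move/leq_ltn_trans; apply; rewrite ltn_exp2l //.
by have : 0 < 2 ^ ht Lg v by [rewrite expn_gt0]; nia.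
Qed.

(** Invariant: after [i] passes all nodes from [N - i] on are correct. Each pass is charged by the
    size of its node. *)
Lemma merge_spec (fa fb : nat -> nat) s :
  ctx s -> (forall k, fa k < B) -> (forall k, fb k < B) ->
  (forall k, k < N -> [/\ s TREEA (N + k) = fa k,
     s TREEB (N + k) = fb k & s TREEP (N + k) = B]) ->
  runs merge_tree s (\sum_(0 <= i < N.-1) csize merge_node * node_bits (N.-1 - i) +
                N * (forsize (var SIZE - lit 1)%P * w))
   (fun s' => forall v, 0 < v < N.*2 -> [/\ s' TREEA v = node fa v,
     s' TREEB v = node fb v & s' TREEP v = B ^ (2 ^ ht Lg v)]).
Proof.
move=> cs hfa hfb leaves; have N0 := N_gt0.
pose I i (s' : store) := forall v, N - i <= v < N.*2 -> [/\ s' TREEA v = node fa v,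
     s' TREEB v = node fb v & s' TREEP v = B ^ (2 ^ ht Lg v)].
have -> : N * (forsize (var SIZE - lit 1)%P * w) =
  (N.-1).+1 * (forsize (var SIZE - lit 1)%P * w) by rewrite prednK.
apply: (@runs_for w N.-1 I) => //.
- by apply: lt_wN; lia.
- move=> s' ag; have c' := ctx_agree ag cs isT; rewrite /= (ctx_N c') subn1.
  by do !split => //; apply: lt_wN.
- move=> v hv; have -> : v = N + (v - N) by lia.
  have [e1 e2 e3] := leaves (v - N) ltac:(lia).
  by rewrite !updateE /= e1 e2 e3 !node_leaf ?ht_leaf ?leq_addr ?expn0 ?expn1 //; lia.
- move=> i s' hi ag si Ii; have c' := ctx_agree ag cs isT.
  pose v := N.-1 - i; rewrite -/v.
  have v0 : 0 < v by rewrite /v; lia. have vN : v < N by rewrite /v; lia.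
  have [a1 b1 p1] := Ii v.*2 ltac:(rewrite /v; lia).
  have [a2 b2 p2] := Ii v.*2.+1 ltac:(rewrite /v; lia).
  have bv0 : 0 < node_bits v by rewrite !muln_gt0 Lg0 expn_gt0.
  have le_h : B ^ (2 ^ ht Lg v.*2) <= B ^ (2 ^ ht Lg v).
    by rewrite leq_pexp2l ?B_gt0 // leq_exp2l // (ht_left v0 vN).
  have ltn_ f u : (forall k, f k < B) -> ht Lg u = ht Lg v.*2 -> node f u < 2 ^ node_bits v.
    move=> hf hu; apply: lt_node_bits; apply: leq_trans le_h; apply: ltnW.
    by rewrite hu; apply: block_lt => //; apply: B_gt0.
  have ltp_ u : ht Lg u = ht Lg v.*2 -> B ^ (2 ^ ht Lg u) < 2 ^ node_bits v.
    by move=> ->; apply: lt_node_bits.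
  have hr := ht_right v0 vN.
  have e2v : 2 * v = v.*2 by lia. have e2v1 : v.*2 + 1 = v.*2.+1 by lia.
  have ev : N - 1 - i = v by rewrite /v; lia.
  have nev : (v.*2 == v) = false by lia. have nev1 : (v.*2.+1 == v) = false by lia.
  apply: lin_seq; apply: lin_assign => //.
    by rewrite /= (ctx_N c') si; do !split => //; apply: lt_node_bitsN; lia.
  have -> : eval s' (lit 0) = 0 by [].
  have -> : eval s' (var SIZE - lit 1 - var IDX)%P = v by rewrite /= (ctx_N c') si.
  apply: lin_seq; apply: lin_assign => //.
  + by rewrite /= updateE /=; split=> //; apply: lt_node_bitsN; lia.
  + rewrite /= !updateE /= e2v e2v1 a1 a2 p1.
    by do !split => //; by [apply: lt_node_bitsN; lia | apply: ltn_ | apply: ltp_].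
  rewrite [eval _ (var NODE)]/= [eval _ (_ + _)%P]/= !updateE /= e2v e2v1 a1 a2 p1.
  apply: lin_seq; apply: lin_assign => //.
  + by rewrite /= !updateE /=; split=> //; apply: lt_node_bitsN; lia.
  + rewrite /= !updateE /= e2v e2v1 b1 b2 p1.
    by do !split => //; by [apply: lt_node_bitsN; lia | apply: ltn_ | apply: ltp_].
  rewrite [eval _ (var NODE)]/= [eval _ (_ + _)%P]/= !updateE /= e2v e2v1 b1 b2 p1.
  apply: lin_assign => //.
  + by rewrite /= !updateE /=; split=> //; apply: lt_node_bitsN; lia.
  + rewrite /= !updateE /= e2v e2v1 p1 p2.
    by do !split => //; by [apply: lt_node_bitsN; lia | apply: ltn_ | apply: ltp_].
  rewrite [eval _ (var NODE)]/= [eval _ (_ * _)%P]/= !updateE /= e2v e2v1 p1 p2.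
  move=> _ u hu; rewrite !updateE /=.
  have [->|ne] := eqVneq u v.
    split.
    * by rewrite (node_split _ v0 vN).
    * by rewrite (node_split _ v0 vN).
    by rewrite hr (ht_left v0 vN) -expnD addnn -mul2n -expnS.
  by apply: Ii; move: ne hu; rewrite /v; lia.
move=> s' ag Is v hv; apply: Is; lia.
Qed.

Lemma multiply_spec (x y : nat -> nat) s :
  ctx s -> (forall k, x k < B) -> (forall k, y k < B) ->
  (forall k j, N <= k + j -> x k * y j = 0) ->
  s TREEA 1 = node x 1 -> s TREEB 1 = node y 1 ->
  runs multiply s (csize multiply * node_bits 1)
    (fun s' => s' TREEC 1 =
       node (fun i => \sum_(0 <= k < N | k <= i) x k * y (i - k)) 1).
Proof.
move=> cs hx hy xy0 ex ey.
apply: lin_assign => //.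
- by rewrite !muln_gt0 Lg0 expn_gt0.
- rewrite /= ex ey; do !split => //; apply: lt_node_bits; apply: ltnW;
    by apply: block_lt => //; apply: B_gt0.
rewrite updateE /= ex ey ht1 /block mul1n.
under eq_bigr do rewrite addKn.
under [X in _ * X = _]eq_bigr do rewrite addKn.
rewrite kronecker_mul //; apply: eq_bigr => i _; by rewrite addKn.
Qed.

(** Invariant: after [i] passes the nodes up to [2i + 1] are correct. As digits are below [B],
    dividing by the power of the left child yields exactly the right half. *)
Lemma split_spec (f : nat -> nat) s :
  ctx s -> (forall k, f k < B) ->
  (forall v, 0 < v < N.*2 -> s TREEP v = B ^ (2 ^ ht Lg v)) ->
  s TREEC 1 = node f 1 ->
  runs split_tree s (\sum_(0 <= i < N.-1) csize split_node * node_bits i.+1 +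
                 N * (forsize (var SIZE - lit 1)%P * w))
   (fun s' => forall k, k < N -> s' TREEC (N + k) = f k).
Proof.
move=> cs hf hp root; have N0 := N_gt0.
pose I i (s' : store) := forall v, 0 < v <= i.*2.+1 -> s' TREEC v = node f v.
have -> : N * (forsize (var SIZE - lit 1)%P * w) =
  (N.-1).+1 * (forsize (var SIZE - lit 1)%P * w) by rewrite prednK.
apply: (@runs_for w N.-1 I) => //.
- by apply: lt_wN; lia.
- move=> s' ag; have c' := ctx_agree ag cs isT; rewrite /= (ctx_N c') subn1.
  by do !split => //; apply: lt_wN.
- by move=> v hv; have -> : v = 1 by lia.
- move=> i s' hi ag si Ii; have c' := ctx_agree ag cs isT.
  pose v := i.+1; rewrite -/v.
  have v0 : 0 < v by rewrite /v; lia. have vN : v < N by rewrite /v; lia.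
  have cv := Ii v ltac:(rewrite /v; lia).
  have pv : s' TREEP v.*2 = B ^ (2 ^ ht Lg v.*2) by rewrite ag ?hp //; lia.
  have bv0 : 0 < node_bits v by rewrite !muln_gt0 Lg0 expn_gt0.
  have le_h : B ^ (2 ^ ht Lg v.*2) <= B ^ (2 ^ ht Lg v).
    by rewrite leq_pexp2l ?B_gt0 // leq_exp2l // (ht_left v0 vN).
  have hr := ht_right v0 vN.
  have e2v : 2 * v = v.*2 by lia. have e2v1 : v.*2 + 1 = v.*2.+1 by lia.
  have ev : i + 1 = v by rewrite /v; lia.
  have nev : (v == v.*2.+1) = false by lia. have nev1 : (v == v.*2) = false by lia.
  have hv1 : node f v < 2 ^ node_bits v.
    by apply: lt_node_bits; apply/ltnW/block_lt => //; apply: B_gt0.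
  have hv2 : node f v.*2.+1 < 2 ^ node_bits v.
    apply: lt_node_bits; apply: leq_trans le_h; apply: ltnW; rewrite -hr.
    by apply/block_lt => //; apply: B_gt0.
  have hv3 : B ^ (2 ^ ht Lg v.*2) < 2 ^ node_bits v by apply: lt_node_bits.
  have dv : node f v %/ B ^ (2 ^ ht Lg v.*2) = node f v.*2.+1.
    by rewrite hr (ht_left v0 vN) block_div // B_gt0.
  have mv : node f v - node f v.*2.+1 * B ^ (2 ^ ht Lg v.*2) = node f v.*2.
    by rewrite (node_split _ v0 vN) addnK.
  have v_lt : v < 2 ^ node_bits v by apply: lt_node_bitsN; lia.
  have i_lt : i < 2 ^ node_bits v by apply: lt_node_bitsN; lia.
  apply: lin_seq; apply: lin_assign => //.
    by rewrite /= si; do !split => //; apply: lt_node_bitsN; lia.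
  have -> : eval s' (lit 0) = 0 by [].
  have -> : eval s' (var IDX + lit 1)%P = v by rewrite /= si addn1.
  apply: lin_seq; apply: lin_assign => //.
  + by rewrite /= !updateE /= e2v cv pv.
  rewrite [eval _ right_child]/= [eval _ (_ / _)%P]/= !updateE /= e2v e2v1 cv pv dv.
  apply: lin_assign => //.
  + by rewrite /= !updateE /= e2v e2v1 nev eqxx cv pv.
  rewrite [eval _ left_child]/= [eval _ (_ - _)%P]/= !updateE /=.
  rewrite e2v e2v1 nev eqxx cv pv mv => _ u hu; rewrite !updateE /=.
  have [->|ne] := eqVneq u v.*2; first by [].
  have [->|ne1] := eqVneq u v.*2.+1; first by [].
  by apply: Ii; move: ne ne1 hu; rewrite /v; lia.
move=> s' ag Is k kN; rewrite Is ?node_leaf //; lia.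
Qed.

Definition convolve_const :=
  forcost (var SIZE) fill_leaves + forcost LENGTHS@[lit 0] fill_weight +
  csize merge_node + csize multiply + csize split_node +
  2 * forsize (var SIZE - lit 1)%P.

(** The nodes visited are 1 to [N - 1], so [sum_ht] applies. *)
Lemma sum_node_bits c :
  \sum_(0 <= i < N.-1) c * node_bits i.+1 = c * (4 * Lg * (Lg * N)).
Proof.
rewrite -sum_ht [X in _ = _ * (_ * X)]big_nat_shift subn1 !big_distrr /=.
by apply: eq_bigr => i _; rewrite addn1.
Qed.

Lemma sum_node_bits_rev c :
  \sum_(0 <= i < N.-1) c * node_bits (N.-1 - i) = c * (4 * Lg * (Lg * N)).
Proof.
rewrite -sum_node_bits big_nat_rev /= big_nat_cond [RHS]big_nat_cond.
apply: eq_bigr => i; rewrite andbT => /andP[_ hi].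
by have -> : N.-1 - (0 + N.-1 - i.+1) = i.+1 by lia.
Qed.

Lemma convolve_spec l q c s : ctx s -> l <= Lg -> 0 < q <= Q -> c <= Q ->
  s PREFIX 0 = 2 ^ l -> s MODULUS 0 = q -> s RESIDUE 0 = c ->
  runs convolve s (convolve_const * (N * w ^ 2))
   (fun s' => forall i, i < N -> s' TREEC (N + i) = digit (act l q c) i).
Proof.
move=> cs lL qQ cQ sH sq sc; set a := act l q c.
have wN := fun k => weight_lt a k (leqnn n).
have bB k : bv k < B by apply: leq_ltn_trans (leq_b1 _) _; have := N_le_cube; lia.
pose t1 := (forcost (var SIZE) fill_leaves + forcost LENGTHS@[lit 0] fill_weight) * (N * w).
pose t2 c0 := c0 * (4 * Lg * (Lg * N)) + N * (forsize (var SIZE - lit 1)%P * w).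
apply: (@runs_weaken _ _ (t1 + (t2 (csize merge_node) +
   (csize multiply * node_bits 1 + t2 (csize split_node))))) => [|s' _ h|]; first 1 last.
- exact: h.
- apply/runs_seq/runs_frame.
  apply: runs_weaken (fill_spec cs lL qQ cQ sH sq sc) => // s1 ag1 h1 _.
  have c1 := ctx_agree ag1 cs isT.
  apply/runs_seq; rewrite /t2 -sum_node_bits_rev.
  apply: runs_weaken (merge_spec c1 wN bB h1) => // s2 ag2 h2.
  have c2 := ctx_agree ag2 c1 isT.
  have [e1 e2 _] := h2 1 ltac:(have := N_gt0; lia).
  apply/runs_seq.
  apply: runs_weaken (multiply_spec c2 wN bB _ e1 e2) => //; last first.
    exact: weight_bv.
  move=> s3 ag3 h3; have c3 := ctx_agree ag3 c2 isT.
  rewrite -sum_node_bits; apply: split_spec c3 _ _ h3; first exact: digit_lt.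
  by move=> v hv; rewrite ag3 //; have [] := h2 v hv.
rewrite /t1 /t2 /convolve_const ht1.
move: (forcost _ _) (forcost _ _) (csize _) (csize _) (csize _) (forsize _) => *.
nia.
Qed.

(** The test number [t] stands for the triple [(l, q - 1, c)] written in base [Q]. *)
Definition level t := t %/ (Q * Q).
Definition test t := act (level t) (t %/ Q %% Q).+1 (t %% Q).

(** * Tests and the least position they reveal *)

Lemma Q_gt0 : 0 < Q. Proof. by rewrite muln_gt0 expn_gt0 Lg0. Qed.

Lemma test_index l q c : q < Q -> c < Q ->
  level ((l * Q + q) * Q + c) = l /\ test ((l * Q + q) * Q + c) = act l q.+1 c.
Proof.
move=> hq hc.
have e1 : ((l * Q + q) * Q + c) %/ Q = l * Q + q.
  by rewrite divnMDl ?Q_gt0 // divn_small // addn0.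
have e2 : level ((l * Q + q) * Q + c) = l.
  by rewrite /level divnMA e1 divnMDl ?Q_gt0 // divn_small // addn0.
split=> //; rewrite /test e2 e1 !modnMDl !modn_small //.
Qed.

(** If test [t] sees one witness, [bst] does not exceed it; if it sees a crowd, [bst] already lies
    in the first half of the prefix. *)
Definition settled t i bst :=
  (rank_count (test t) i = 1 -> bst <= rank_sum (test t) i) /\
  (2 * Lg < rank_count (test t) i -> 2 * bst < 2 ^ level t).

(** Fewer than [2 * Lg] other witnesses share the prefix, so some [q <= Q] separates [p] from all of
    them; the test uses that [q] and the class of [p]. *)
Lemma isolating_test i p l : wit i p -> p < 2 ^ l ->
  rank_count (fun p => p < 2 ^ l) i <= 2 * Lg ->
  exists t, [/\ t < l.+1 * (Q * Q), rank_count (test t) i = 1 & rank_sum (test t) i = p].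
Proof.
move=> wp pl hc; have pn : p < n by case/and4P: wp.
pose s := [seq p' <- index_iota 0 n | ((p' < 2 ^ l) && wit i p') && (p' != p)].
have sz : size s < 2 * Lg.
  apply: leq_trans hc; rewrite size_filter -sum1_count /rank_count !big_mkord.
  rewrite big_mkcond (bigD1 (Ordinal pn)) //= eqxx andbF add0n.
  rewrite [X in _ < X](bigD1 (Ordinal pn)) //= pl wp add1n ltnS.
  by apply: leq_sum => j _; case: (_ < _); case: (wit _ _); case: (_ == _).
have [|p' ||q [q0 qM hq]] := @exists_separating_modulus s p Lg (2 * Lg ^ 2).
- by apply: ltn_trans pn _; apply: nN.
- rewrite mem_filter mem_index_iota => /andP[/andP[_ ->]] /= pn'; split=> //.
  by apply: ltn_trans pn' _; apply: nN.
- rewrite expnS expn1 mulnA ltn_pmul2r //.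
have qQ : q.-1 < Q by move: q0 qM; rewrite -mul2n mulnA; lia.
have cQ : p %% q < Q by apply: leq_trans (ltn_pmod p q0) _; lia.
have [_ et] := test_index l qQ cQ; rewrite (prednK q0) in et.
exists ((l * Q + q.-1) * Q + p %% q); rewrite et; split.
- rewrite mulnA mulSn; nia.
all: have [] // := @count_isolated (act l q (p %% q)) i p; try by rewrite /act pl eqxx.
all: move=> p' /andP[p'l p'q] wp'; apply/eqP; apply: contraT => ne.
all: have : p' \in s by rewrite mem_filter p'l wp' ne mem_index_iota; case/and4P: wp'.
all: by move/hq; rewrite p'q.
Qed.

Lemma count_first i : rank_count (fun p => p < 2 ^ 0) i <= 1.
Proof.
rewrite /rank_count; apply: (@leq_trans (\sum_(0 <= p < n) (p == 0))).
  by apply: leq_sum => j _; rewrite expn0 ltnS leqn0; case: (_ == _) => //; apply: leq_b1.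
by rewrite big_ltn // big_nat_cond big1 // => j; lia.
Qed.

(** Induction on [l]. In a sparse prefix the isolating test of [p] bounds [bst]. In a crowded one
    [bst] lies in the first half, so a later [p] is no issue and an earlier one falls to the
    induction hypothesis. *)
Lemma settled_min i bst l :
  (forall t, t < l.+1 * (Q * Q) -> settled t i bst) ->
  forall p, wit i p -> p < 2 ^ l -> bst <= p.
Proof.
have sparse k p : (forall t, t < k.+1 * (Q * Q) -> settled t i bst) ->
    wit i p -> p < 2 ^ k -> rank_count (fun p => p < 2 ^ k) i <= 2 * Lg -> bst <= p.
  move=> hs wp pk le; have [t [tlt t1 t2]] := isolating_test wp pk le.
  by have [h _] := hs t tlt; rewrite -t2; apply: h.
elim: l => [|l IH] hs p wp pl.
  apply: sparse hs wp pl _; apply: leq_trans (count_first i) _; lia.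
have [le|gt] := leqP (rank_count (fun p => p < 2 ^ l.+1) i) (2 * Lg).
  exact: sparse hs wp pl le.
(* With modulus 1 and class 0 the test sees the whole prefix. *)
have [el et] := test_index l.+1 Q_gt0 Q_gt0.
have [_] := hs ((l.+1 * Q + 0) * Q + 0) ltac:(have := Q_gt0; nia).
rewrite el et; have -> : rank_count (act l.+1 1 0) i = rank_count (fun p => p < 2 ^ l.+1) i.
  by apply: eq_bigr => j _; rewrite /act modn1 eqxx andbT.
move=> /(_ gt); rewrite expnS ltn_pmul2l // => hb.
have [pl'|] := ltnP p (2 ^ l); last by apply/leq_trans/ltnW.
by apply: IH pl' => // t ht; apply: hs; apply: leq_trans ht _; nia.
Qed.

Definition crowded := exists i l, [/\ i < N, l < Lg,
  forall p, wit i p -> 2 ^ l <= p & 2 * Lg < rank_count (fun p => p < 2 ^ l.+1) i].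

(** [done t i] records that test [t] has been scanned at index [i], and [N] in [BEST] that no
    witness was found. A raised flag must certify [crowded], so the fallback is charged only to rare
    orders. *)
Record inv (done : nat -> nat -> Prop) (s : store) : Prop := Inv {
  inv_best : forall i, i < N -> s BEST i = N \/ wit i (s BEST i);
  inv_flag : s FLAG 0 <= 1;
  inv_settled : s FLAG 0 = 0 ->
    forall t i, i < N -> done t i -> settled t i (s BEST i);
  inv_crowded : s FLAG 0 <> 0 -> crowded }.

(** The flag is raised when the prefix holds a crowd of witnesses although no
   witness was found in its first half.  Since [x - (x - y)] is the minimum of [x]
   and [y], the last assignment lowers the best position to the revealed one. *)
Definition scan_cell : cmd :=
  set_var COUNT (modulo TREEC@[var SIZE + var IDX] (var SIZE));;
  set_var FLAG (lit 1 - (lit 1 - (var FLAG + (var COUNT - var CROWD) *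
    (lit 2 * BEST@[var IDX] + lit 1 - var PREFIX))))%P;;
  Assign BEST (var IDX) (BEST@[var IDX] - equal (var COUNT) (lit 1) *
    (BEST@[var IDX] - TREEC@[var SIZE + var IDX] / var SIZE))%P.

Definition scan : cmd := For IDX (var SIZE) scan_cell.

Lemma best_le s i done : inv done s -> i < N -> s BEST i <= N.
Proof.
move=> h iN; have [->//|/and4P[/ltnW le _ _ _]] := inv_best h iN.
by apply: leq_trans le _; apply/ltnW/nN.
Qed.

Lemma scan_spec t s : ctx s -> level t <= Lg -> s PREFIX 0 = 2 ^ level t ->
  (forall i, i < N -> s TREEC (N + i) = digit (test t) i) ->
  inv (fun t' _ => t' < t) s ->
  runs scan s (forcost (var SIZE) scan_cell * (N * w)) (inv (fun t' _ => t' < t.+1)).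
Proof.
move=> cs hl sH digits invs; have N0 := N_gt0.
pose I j := inv (fun t' i => t' < t \/ t' = t /\ i < j).
apply: (@for_lin w N _ I) => //; rewrite ?lt_wN //.
- by move=> s' ag; have c' := ctx_agree ag cs isT; rewrite /= (ctx_N c') lt_wN.
- case: invs => h1 h2 h3 h4; split; rewrite ?updateE //=.
  by move=> f0 t' i iN [lt|[]] //; apply: h3.
- move=> j s' jN ag sj Ij; have c' := ctx_agree ag cs isT.
  have sH' : s' PREFIX 0 = 2 ^ level t by rewrite ag.
  have sd : s' TREEC (N + j) = digit (test t) j by rewrite ag ?digits.
  have bN := best_le Ij jN; have fl := inv_flag Ij.
  have cntN := count_lt (test t) j.
  have lN : 2 ^ level t <= N by rewrite leq_exp2l.
  have LN : Lg < N by apply: ltn_expl.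
  have dB := digit_lt (test t) j.
  pose k := rank_count (test t) j; pose r := rank_sum (test t) j; pose b := s' BEST j.
  pose f := s' FLAG 0; pose h := 2 ^ level t.
  (* Since [1 - (1 - x)] is the minimum of 1 and [x], the flag rises exactly when the count exceeds
     [2 * Lg] and [h <= 2 * b]. *)
  pose f' := 1 - (1 - (f + (k - 2 * Lg) * (2 * b + 1 - h))).
  pose b' := b - (k == 1) * (b - r).
  have kw : 2 * Lg < 2 ^ w.
    by apply: leq_trans (ltn_expl _ (isT : 1 < 2)) _; rewrite leq_exp2l //; lia.
  apply: lin_seq; apply: lin_assign => //.
    by rewrite /= (ctx_N c') sj sd; do !split => //; by [apply: lt_wN; lia | apply: lt_w; lia].
  have -> : eval s' (lit 0) = 0 by [].
  have -> : eval s' (modulo TREEC@[var SIZE + var IDX] (var SIZE)) = k.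
    by rewrite eval_modulo /= (ctx_N c') sj sd digit_mod.
  apply: lin_seq; apply: lin_assign => //.
    rewrite /= !updateE /= (ctx_K c') sj sH'; do !split => //; apply: lt_wN; lia.
  set s1 := update s' COUNT 0 k; have -> : eval s1 (lit 0) = 0 by [].
  have -> : eval s1 (lit 1 - (lit 1 - (var FLAG + (var COUNT - var CROWD) *
    (lit 2 * BEST@[var IDX] + lit 1 - var PREFIX))))%P = f'.
    by rewrite /= /s1 !updateE /= (ctx_K c') sj sH'.
  apply: lin_assign => //.
  + by rewrite /= /s1 !updateE /= sj; do !split => //; apply: lt_wN; lia.
  + rewrite /= /s1 !updateE /= !(ctx_N c') !sj sd.
    by do !split => //; by [apply: lt_wN; lia | apply: lt_w; lia].
  set s2 := update s1 FLAG 0 f'.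
  set e := (_ - equal _ _ * _)%P; have -> : eval s2 e = b'.
    rewrite -[LHS]/(eval s2 BEST@[var IDX] - eval s2 (equal (var COUNT) (lit 1)) *
      eval s2 (BEST@[var IDX] - TREEC@[var SIZE + var IDX] / var SIZE)%P) eval_equal.
    by rewrite /= /s2 /s1 !updateE /= (ctx_N c') sj sd digit_div.
  have -> : eval s2 (var IDX) = j by rewrite /= /s2 /s1 !updateE.
  move=> _; rewrite /I.
  have bb' : b' <= b by rewrite /b' leq_subr.
  have f'0 : f' = 0 -> f = 0 /\ (2 * Lg < k -> 2 * b < h).
    rewrite /f' => h0; have /eqP : f + (k - 2 * Lg) * (2 * b + 1 - h) = 0.
      by move: h0; move: (f + _) => x; lia.
    by rewrite addn_eq0 muln_eq0 => /andP[/eqP-> /orP[] h1]; split=> //; lia.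
  split; rewrite ?/s2 ?/s1.
  + move=> i iN; rewrite !updateE /=; case: (eqVneq i j) => [->|_]; last exact: (inv_best Ij).
    rewrite /b'; have [k1|_] := eqVneq k 1; last by rewrite subn0; apply: (inv_best Ij).
    have [ra rw] := count1P k1; have [le|lt] := leqP b r.
      by rewrite mul1n (_ : b - r = 0) ?subn0; [apply: (inv_best Ij) | lia].
    by right; rewrite mul1n subKn // ltnW.
  + by rewrite !updateE /= /f' leq_subr.
  + rewrite !updateE /= => /f'0[f0 hk] t' i iN dn; rewrite !updateE /=.
    have old := inv_settled Ij f0 iN.
    have [ij|ne] := eqVneq i j; last first.
      by apply: old; case: dn => [|[-> ]]; [left | rewrite ltnS leq_eqVlt (negbTE ne); right].
    subst i; case: dn => [lt|[-> _]].
      have [o1 o2] := old t' (or_introl lt); split=> [/o1|/o2]; first exact: leq_trans.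
      by apply: leq_ltn_trans; rewrite leq_mul2l bb'.
    split=> [k1|/hk]; last by apply: leq_ltn_trans; rewrite leq_mul2l bb'.
    by rewrite /b' [k]k1 eqxx mul1n -/r; lia.
  rewrite !updateE /=; have [fz|fnz _] := eqVneq f 0; last by apply: (inv_crowded Ij); apply/eqP.
  move=> f'nz; have /andP[kb bh] : (2 * Lg < k) && (h <= 2 * b).
    move: f'nz; rewrite /f' fz add0n; clear; have [|] := leqP k (2 * Lg) => hk.
      by rewrite (_ : k - _ = 0) ?mul0n; lia.
    have [|] := leqP h (2 * b) => hb //.
    by rewrite (_ : _ - h = 0) ?muln0; lia.
  have kle l : level t = l -> k <= rank_count (fun p => p < 2 ^ l) j.
    by move=> <-; apply: leq_sum => p _; rewrite /test /act; case: (_ < _); case: (_ == _); case: wit.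
  (* The prefix of length one holds at most one witness, so a crowd forces a positive level. *)
  case el : (level t) => [|l].
    by have := leq_trans (kle _ el) (count_first j); lia.
  exists j, l; split=> //; first by rewrite -el.
    move=> p wp; rewrite leqNgt; apply/negP => pl.
    have : b <= p.
      (* All tests of level at most [l] come before [t] and are settled; a witness before [2 ^ l]
         would thus force [b < 2 ^ l], against [h <= 2 * b]. *)
      apply: settled_min wp pl => t' ht'; apply: (inv_settled Ij fz) => //; left.
      by rewrite -el in ht'; apply: leq_trans ht' _; rewrite /level leq_trunc_div.
    by move: bh; rewrite /h el expnS; lia.
  by apply: leq_trans kb (kle _ el).
- move=> s' ag; case=> h1 h2 h3 h4; split=> // f0 t' i iN; rewrite ltnS leq_eqVlt.
  by move=> /predU1P[->|lt]; apply: h3; auto.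
Qed.

(** * Running all tests *)

Definition choose_test : cmd :=
  set_var PREFIX POW@[var TEST / (var MODULI * var MODULI)];;
  set_var MODULUS (modulo (var TEST / var MODULI) (var MODULI) + lit 1)%P;;
  set_var RESIDUE (modulo (var TEST) (var MODULI)).

Definition run_test : cmd := choose_test;; convolve;; scan.

Definition tests_number : expr := ((var LOG + lit 1) * (var MODULI * var MODULI))%P.
Definition run_tests : cmd := For TEST tests_number run_test.

Definition test_const :=
  csize choose_test + convolve_const + forcost (var SIZE) scan_cell.

Local Notation T := (Lg.+1 * (Q * Q)).

Lemma T_le : T < w ^ 5.
Proof.
have hQ : Q < w ^ 2 by rewrite !expnS !expn0; nia.
rewrite -[5]/(1 + (2 + 2)) !expnD expn1; apply: ltn_mul; first lia.
exact: ltn_mul.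
Qed.

Lemma T_lt_w : T < 2 ^ w.
Proof.
have h : Lg < 2 ^ Lg by apply: ltn_expl.
have hT : T <= N * (16 * ((N * N) * (N * N))).
  apply: leq_mul => //; have -> : Q * Q = 16 * ((Lg * Lg) * (Lg * Lg)) by lia.
  by rewrite leq_mul2l !leq_mul ?(ltnW h) ?orbT.
apply: leq_ltn_trans hT _.
(* The factor 10 in [w] accommodates this exponent, as [Lg] is positive. *)
apply: (@leq_trans (2 ^ (5 + 5 * Lg))); last by rewrite leq_exp2l //; lia.
rewrite expnD mulnC [5 * Lg]mulnC expnM -[2 ^ 5]/32 mulnC.
have : 0 < N ^ 5 by rewrite !expn_gt0.
by rewrite !expnS expn0; lia.
Qed.

(** Fewer than [w ^ 5] tests, each of time of order [N * w ^ 2], account for the exponent 7. *)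
Lemma run_tests_spec s : ctx s -> inv (fun _ _ => False) s ->
  runs run_tests s ((test_const + 2 * forsize tests_number) * (N * w ^ 7))
    (inv (fun t _ => t < T)).
Proof.
move=> cs invs; have N0 := N_gt0.
have le : \sum_(0 <= i < T) test_const * (N * w ^ 2) + T.+1 * (forsize tests_number * w) <=
    (test_const + 2 * forsize tests_number) * (N * w ^ 7).
  rewrite sum_nat_const_nat subn0 mulnDl leq_add //.
    rewrite mulnCA leq_mul2l mulnCA leq_mul2l; apply/orP; right; apply/orP; right.
    by rewrite -[7]/(5 + 2) expnD leq_mul2r (ltnW T_le) orbT.
  apply: (@leq_trans (2 * w ^ 5 * (forsize tests_number * w))).
    by rewrite leq_mul2r; apply/orP; right; have := T_le; lia.
  have -> : 2 * w ^ 5 * (forsize tests_number * w) = 2 * forsize tests_number * (w ^ 5 * w).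
    by move: (w ^ 5) => x; lia.
  rewrite leq_mul2l -expnSr; apply/orP; right; apply: leq_trans (leq_pmull _ N0).
  by rewrite leq_pexp2l.
apply: runs_weaken le (fun _ _ h => h) _.
apply: (@runs_for w T (fun t => inv (fun t' _ => t' < t))) => //.
- exact: T_lt_w.
- move=> s' ag; have c' := ctx_agree ag cs isT.
  rewrite /= (ctx_Lg c') (ctx_Q c') addn1; do !split => //; try exact: Q_lt.
  by apply: lt_wN; apply/ltnW/ltn_expl.
- case: invs => h1 h2 h3 h4; split; rewrite ?updateE //=.
- move=> t s' tT ag st invt; have c' := ctx_agree ag cs isT.
  have lev : level t <= Lg by rewrite -ltnS /level ltn_divLR // muln_gt0 Q_gt0.
  have tw : t < 2 ^ w by apply: ltn_trans tT T_lt_w.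
  have Qw := Q_lt.
  rewrite {1}/test_const -addnA mulnDl.
  pose mid s1 := [/\ s1 PREFIX 0 = 2 ^ level t, s1 MODULUS 0 = (t %/ Q %% Q).+1,
    s1 RESIDUE 0 = t %% Q & agree [:: PREFIX; MODULUS; RESIDUE] s' s1].
  have choice : lin w choose_test s' mid.
    have e1 : eval s' POW@[var TEST / (var MODULI * var MODULI)] = 2 ^ level t.
      by rewrite /= st (ctx_Q c') (ctx_pow c').
    have r1 : s' POW (t %/ (Q * Q)) < 2 ^ w.
      by rewrite (ctx_pow c') // lt_wN // leq_exp2l.
    apply: lin_seq; apply: lin_assign => //; first by rewrite /= st !(ctx_Q c').
    rewrite e1.
    apply: lin_seq; apply: lin_assign => //; first by rewrite /= !updateE /= st !(ctx_Q c').
    set s1 := update s' _ _ _.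
    have -> : eval s1 (modulo (var TEST / var MODULI) (var MODULI) + lit 1)%P =
        (t %/ Q %% Q).+1.
      rewrite -[LHS]/(eval s1 (modulo (var TEST / var MODULI)%P (var MODULI)) + 1).
      by rewrite eval_modulo /= /s1 !updateE /= st (ctx_Q c') addn1.
    apply: lin_assign => //; first by rewrite /= /s1 !updateE /= st (ctx_Q c').
    rewrite eval_modulo /= /s1 !updateE /= st (ctx_Q c').
    split=> // A i; rewrite !inE !negb_or => /and3P[/negbTE n1 /negbTE n2 /negbTE n3].
    by rewrite /s1 !updateE n1 n2 n3.
  apply: runs_seq.
  apply: runs_weaken choice => [|s1 _ [f1 f2 f3 ag1]].
    rewrite leq_mul2l; apply/orP; right; apply: leq_trans (leq_pmull _ N0).
    by rewrite -{1}[w]expn1 leq_pexp2l.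
  have Q0 := Q_gt0.
  have c1 := ctx_agree ag1 c' isT.
  have qQ : 0 < (t %/ Q %% Q).+1 <= Q by rewrite /= ltn_pmod.
  have cQ : t %% Q <= Q by apply/ltnW/ltn_pmod.
  rewrite mulnDl; apply: runs_seq; apply: runs_weaken (convolve_spec c1 lev qQ cQ f1 f2 f3) => //.
  move=> s2 ag2 dig; have c2 := ctx_agree ag2 c1 isT.
  have inv2 : inv (fun t' _ => t' < t) s2.
    have eq A i : A \in [:: BEST; FLAG] -> s2 A i = s' A i.
      by rewrite !inE => /orP[] /eqP->; rewrite ag2 // ag1.
    case: invt => h1 h2 h3 h4; split.
    + by move=> i iN; rewrite eq //; apply: h1.
    + by rewrite eq.
    + by rewrite eq // => f0 t' i iN; rewrite eq //; apply: h3.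
    + by rewrite eq.
  have f1' : s2 PREFIX 0 = 2 ^ level t by rewrite ag2.
  apply: runs_weaken (scan_spec c2 lev f1' dig inv2) => [|s3 _ [h1 h2 h3 h4] _].
    by rewrite !leq_mul2l -{1}[w]expn1 leq_pexp2l ?orbT.
  by split=> // *; rewrite ?updateE /=; auto.
Qed.

Definition minimal s := forall i, i < N ->
  (s BEST i = N \/ wit i (s BEST i)) /\ forall p, wit i p -> s BEST i <= p.

(** The prefix of level [Lg] contains every position, so [settled_min] covers all witnesses. *)
Lemma inv_minimal s : inv (fun t _ => t < T) s -> s FLAG 0 = 0 -> minimal s.
Proof.
move=> invs f0 i iN; split; first exact: inv_best invs i iN.
move=> p wp; apply: (@settled_min i _ Lg) (wp) _.
  by move=> t ht; apply: (inv_settled invs).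
by case/and4P: wp => pn _ _ _; apply: ltn_trans pn nN.
Qed.

(** * The quadratic fallback and the output *)

Definition len_a : expr := LENGTHS@[lit 0].
Definition len_b : expr := LENGTHS@[lit 1].
Definition naive_rank : expr := (var IDX / len_b)%P.
Definition naive_left : expr := ORDER@[naive_rank].
Definition naive_right : expr := modulo (var IDX) len_b.

(** One loop over [n * m] codes [p * m + j], for a position [p] and an index [j] of [b]; the
    subtraction lowers the entry to [p] if both bits are set. *)
Definition naive_step : cmd :=
  Assign BEST (naive_left + naive_right)%P
    (BEST@[naive_left + naive_right] - INA@[naive_left] * INB@[naive_right] *
       (BEST@[naive_left + naive_right] - naive_rank))%P.

Definition naive : cmd := For IDX (len_a * len_b)%P naive_step.

Lemma naive_spec s : ctx s -> (forall i, i < N -> s BEST i = N \/ wit i (s BEST i)) ->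
  runs naive s (forcost (len_a * len_b)%P naive_step * (N * N * w)) minimal.
Proof.
move=> cs best; have N0 := N_gt0.
have nmNN : n * m <= N * N by apply: leq_mul; lia.
have NN : N * N <= N ^ 3.
  by rewrite !expnS expn0 muln1 leq_mul2l leq_pmull ?orbT.
pose I u (s' : store) := (forall i, i < N -> s' BEST i = N \/ wit i (s' BEST i)) /\
  forall u', u' < u -> av (sg (u' %/ m)) -> bv (u' %% m) ->
    s' BEST (sg (u' %/ m) + u' %% m) <= u' %/ m.
apply: (@for_lin w (n * m) _ I) => //.
- by rewrite muln_gt0 N0.
- by apply: lt_w; apply: leq_trans nmNN NN.
- move=> s' ag; have c' := ctx_agree ag cs isT.
  by rewrite /= (ctx_n c') (ctx_m c'); do !split => //; apply: lt_wN; lia.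
- move=> u s' hu ag su [I1 I2]; have c' := ctx_agree ag cs isT.
  pose p := u %/ m; pose j := u %% m.
  have pn : p < n by rewrite /p ltn_divLR.
  have jm : j < m by rewrite /j ltn_mod.
  have sgp := sgn p.
  have iN : sg p + j < N by lia.
  have el : eval s' naive_left = sg p by rewrite /= su (ctx_m c') (ctx_sg c').
  have er : eval s' naive_right = j by rewrite eval_modulo /= su (ctx_m c').
  have bN : s' BEST (sg p + j) <= N.
    have [->|/and4P[/ltnW le _ _ _]] := I1 _ iN; first by [].
    by apply: leq_trans le _; apply/ltnW/nN.
  have mw : m < 2 ^ w by apply: lt_wN; lia.
  have uw : u < 2 ^ w by apply: lt_w; apply: leq_trans NN; apply: leq_trans nmNN; apply: ltnW.
  have sw : sg p < 2 ^ w by apply: lt_wN; lia.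
  have rl : reads w s' naive_left by rewrite /= su (ctx_m c') (ctx_sg c').
  have rr : reads w s' naive_right by rewrite /= su (ctx_m c').
  have bw (b : bool) : b < 2 ^ w by apply: lt_wN; apply: leq_trans (leq_b1 b) _.
  pose b := s' BEST (sg p + j).
  pose b' := b - (av (sg p) && bv j) * (b - p).
  set i := (naive_left + naive_right)%P.
  have ei : eval s' i = sg p + j by rewrite -[LHS]/(eval s' naive_left + eval s' naive_right) el er.
  have ri : reads w s' i by split.
  have rk : reads w s' naive_rank by rewrite /= su (ctx_m c').
  apply: lin_assign => //.
  + have h1 : s' BEST (eval s' i) < 2 ^ w by rewrite ei lt_wN.
    have h2 : s' INA (eval s' naive_left) < 2 ^ w by rewrite (ctx_a c').
    have h3 : s' INB (eval s' naive_right) < 2 ^ w by rewrite (ctx_b c').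
    exact: conj (conj ri h1) (conj (conj (conj rl h2) (conj rr h3)) (conj (conj ri h1) rk)).
  set e := (_ - _ * _)%P; have -> : eval s' e = b'.
    rewrite -[LHS]/(s' BEST (eval s' i) - s' INA (eval s' naive_left) *
      s' INB (eval s' naive_right) * (s' BEST (eval s' i) - eval s' naive_rank)).
    rewrite ei el er (ctx_a c') (ctx_b c') /= su (ctx_m c').
    by rewrite /b'; case: (av _); case: (bv _).
  rewrite ei => _.
  have b'b : b' <= b by apply: leq_subr.
  split=> [k kN|u' u'u au bu]; rewrite !updateE /=.
    have [->|_] := eqVneq k (sg p + j); last exact: I1.
    rewrite /b'; case: andP => [[ap bj]|_]; last by rewrite subn0; apply: I1.
    have [le|lt] := leqP b p.
      by rewrite mul1n (_ : b - p = 0) ?subn0; [apply: I1 | lia].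
    by right; rewrite mul1n subKn ?(ltnW lt) // /wit pn leq_addr ap addKn bj.
  move: u'u; rewrite ltnS leq_eqVlt => /predU1P[uu|lt].
    by rewrite uu in au bu *; rewrite eqxx /b' /b /p /j au bu mul1n; lia.
  have old := I2 _ lt au bu.
  by case: eqVneq => [e0|_] //; rewrite e0 in old; apply: leq_trans old.
move=> s' ag [I1 I2] i iN; split; first exact: I1.
move=> p /and4P[pn le ap bj]; have jm := bvm bj.
have := I2 (p * m + (i - sg p)).
rewrite divnMDl // modnMDl divn_small // modn_small // addn0 subnKC //.
by apply=> //; nia.
Qed.

(** At an index without witnesses [BEST] is [N], and the value [sg N] is written. *)
Definition write_cell : cmd := Assign OUT (var IDX) ORDER@[BEST@[var IDX]].
Definition write_output : cmd := For IDX (len_a + len_b)%P write_cell.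

Lemma write_output_spec s : ctx s -> minimal s ->
  runs write_output s (forcost (len_a + len_b)%P write_cell * (N * w))
    (fun s' => minimal s' /\ forall i, i < n + m -> s' OUT i = sg (s' BEST i)).
Proof.
move=> cs mins; have N0 := N_gt0.
pose I u (s' : store) := forall i, i < u -> s' OUT i = sg (s' BEST i).
have mins' s' : agree (IDX :: mods write_cell) s s' -> minimal s'.
  by move=> ag i iN; have [h1 h2] := mins i iN; rewrite ag.
apply: (@for_lin w (n + m) _ I) => //.
- by apply: lt_wN.
- move=> s' ag; have c' := ctx_agree ag cs isT.
  by rewrite /= (ctx_n c') (ctx_m c'); do !split => //; apply: lt_wN; lia.
- move=> u s' hu ag su Iu; have c' := ctx_agree ag cs isT.
  have bN : s' BEST u <= N.
    have [|[->|/and4P[/ltnW le _ _ _]] _] := mins' _ ag u; [by lia | by [] |].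
    by apply: leq_trans le _; apply/ltnW/nN.
  apply: lin_assign => //=; rewrite ?su ?(ctx_sg c').
  + by do !split => //; apply: lt_wN; lia.
  + by do !split => //; apply: lt_wN; have := sgn (s' BEST u); lia.
  move=> _ i; rewrite ltnS leq_eqVlt !updateE /= => /predU1P[->|lt].
    by rewrite eqxx.
  by rewrite (ltn_eqF lt) Iu.
by move=> s' ag Is; split=> //; apply: mins'.
Qed.

Definition solve : cmd := run_tests;; If (var FLAG) naive Skip;; write_output.

Definition solve_const :=
  test_const + 2 * forsize tests_number + (esize (var FLAG)).+1 ^ 2 + 1 +
  forcost (len_a + len_b)%P write_cell.
Definition naive_const := forcost (len_a * len_b)%P naive_step.

(** The boolean [bad] turns the possible call of the fallback into a numerical term that can be
    averaged over the orders. *)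
Lemma solve_spec s (bad : bool) : ctx s -> inv (fun _ _ => False) s -> (crowded -> bad) ->
  runs solve s (solve_const * (N * w ^ 7) + bad * (naive_const * (N * N * w)))
    (fun s' => minimal s' /\ forall i, i < n + m -> s' OUT i = sg (s' BEST i)).
Proof.
move=> cs invs hbad; have N0 := N_gt0.
have w7 : w <= w ^ 7 by rewrite -{1}[w]expn1 leq_pexp2l.
have Nw7 : N * w <= N * w ^ 7 by rewrite leq_mul2l w7 orbT.
have ww7 : w <= N * w ^ 7 by apply: leq_trans w7 _; apply: leq_pmull.
pose t1 := (test_const + 2 * forsize tests_number) * (N * w ^ 7).
pose t2 := (esize (var FLAG)).+1 ^ 2 * w + (w + bad * (naive_const * (N * N * w))).
pose t3 := forcost (len_a + len_b)%P write_cell * (N * w).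
apply: (@runs_weaken _ _ (t1 + (t2 + t3)) _ _ _ _ (fun _ _ h => h)).
  rewrite /t1 /t2 /t3 /solve_const {t1 t2 t3}.
  move: (bad * _) (test_const + 2 * forsize tests_number) ((esize (var FLAG)).+1 ^ 2)
    (forcost (len_a + len_b)%P write_cell) => x c1 c2 c3.
  have h1 : c2 * w <= c2 * (N * w ^ 7) by rewrite leq_mul2l ww7 orbT.
  have h2 : c3 * (N * w) <= c3 * (N * w ^ 7) by rewrite leq_mul2l Nw7 orbT.
  move: h1 h2 ww7; rewrite !mulnDl mul1n; move: (N * w ^ 7) (c2 * w) (c3 * (N * w)); lia.
apply: runs_seq; apply/runs_frame.
apply: runs_weaken (run_tests_spec cs invs) => // s1 ag1 inv1 _.
have c1 := ctx_agree ag1 cs isT.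
apply: runs_seq; apply/runs_frame.
apply: (@runs_weaken _ _ t2 _ minimal) => // [s2 ag2 min2 _|].
  apply: write_output_spec => //; exact: ctx_agree ag2 c1 isT.
apply: runs_if => //.
- by rewrite /=; do !split => //; apply: lt_wN; apply: leq_trans (inv_flag inv1) _.
- move=> fnz; have -> : bad by apply/hbad/(inv_crowded inv1)/eqP.
  apply: runs_weaken (naive_spec c1 (inv_best inv1)) => //.
  by rewrite mul1n leq_addl.
move=> f0; apply: runs_weaken (lin_skip w_gt0 (inv_minimal inv1 f0)) => //.
by rewrite mul1n leq_addr.
Qed.

(** * Computing the size, its logarithm and the parameters *)

Definition double_size : cmd :=
  If (len_a + len_b - var SIZE)%P
    (set_var LOG (var LOG + lit 1)%P;;
     set_var SIZE (lit 2 * var SIZE)%P;;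
     Assign POW (var LOG) (var SIZE))
    Skip.
Definition init_best : cmd := Assign BEST (var IDX) (var SIZE).
Definition first_power : cmd := set_var SIZE (lit 1);; Assign POW (lit 0) (lit 1).
Definition parameters : cmd :=
  set_var CROWD (lit 2 * var LOG)%P;; set_var MODULI (lit 4 * (var LOG * var LOG))%P.

Definition setup : cmd :=
  first_power;; For CTR (len_a + len_b)%P double_size;; parameters;;
  For IDX (var SIZE) init_best.

Definition setup_const :=
  csize first_power + forcost (len_a + len_b)%P double_size + csize parameters +
  forcost (var SIZE) init_best.

Lemma setup_spec s : (forall k, n + m <= 2 ^ k -> Lg <= k) ->
  s LENGTHS 0 = n -> s LENGTHS 1 = m -> (forall k, s INA k = av k) ->
  (forall k, s INB k = bv k) -> (forall p, s ORDER p = sg p) ->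
  (forall A i, OUT <= A -> s A i = 0) ->
  runs setup s (setup_const * (N * w)) (fun s' => ctx s' /\ inv (fun _ _ => False) s').
Proof.
move=> Lmin en em ea eb es zero; have N0 := N_gt0.
have wN : w <= N * w by apply: leq_pmull.
have nw : n < 2 ^ w by apply: lt_wN; lia.
have mw : m < 2 ^ w by apply: lt_wN; lia.
have LN : Lg < N by apply: ltn_expl.
have Lw := lt_wN (ltnW LN).
rewrite /setup_const 3!mulnDl -2!addnA; apply: runs_seq.
apply: (@runs_weaken _ _ (csize first_power * w) _
  (fun s1 => [/\ s1 SIZE 0 = 1, s1 POW 0 = 1 & agree [:: SIZE; POW] s s1])); first 1 last.
- move=> s1 _ [z1 p1 ag1]; apply: runs_seq.
  (* As long as the exponent [k] is below [Lg], every pass so far has doubled the size, hence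
     [u <= k]. *)
  pose I u (s' : store) := exists k, [/\ k <= Lg, s' LOG 0 = k, s' SIZE 0 = 2 ^ k,
    forall j, j <= k -> s' POW j = 2 ^ j & k < Lg -> u <= k].
  apply: (@for_lin w (n + m) _ I) => //.
  + exact: lt_wN.
  + move=> s' ag; rewrite /= !ag // !ag1 // en em.
    by do !split.
  + exists 0; rewrite !updateE /= z1 ag1 // zero //; split=> // j.
    by rewrite leqn0 => /eqP->; rewrite updateE.
  + move=> u s' hu ag su [k [kL lk zk pk uk]].
    have kN : 2 ^ k <= N by rewrite leq_exp2l.
    have en' : s' LENGTHS 0 = n by rewrite ag // ag1.
    have em' : s' LENGTHS 1 = m by rewrite ag // ag1.
    apply: lin_if => //.
    * by rewrite /= en' em' zk; do !split => //; apply: lt_wN.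
    * rewrite /= en' em' zk => ne.
      have kL' : k < Lg.
        by rewrite ltnNge; apply/negP => h; move: (leq_pexp2l (isT : 0 < 2) h); lia.
      have kN' : 2 ^ k.+1 <= N by rewrite leq_exp2l.
      apply: lin_seq; apply: lin_assign => //=.
        by rewrite lk; do !split => //; apply: lt_wN; lia.
      rewrite lk addn1.
      apply: lin_seq; apply: lin_assign => //=; rewrite ?updateE /= ?zk.
        by do !split => //; apply: lt_wN.
      rewrite -expnS; apply: lin_assign => //=; rewrite ?updateE /=.
      - by do !split => //; apply: lt_wN; lia.
      - by do !split => //; apply: lt_wN.
      move=> _; exists k.+1; rewrite !updateE /=; split=> // [j|_]; last exact: uk.
      rewrite leq_eqVlt !updateE /= => /predU1P[->|lt]; first by rewrite eqxx.
      by rewrite (ltn_eqF lt) pk.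
    rewrite /= en' em' zk => e0; apply: lin_skip => // _.
    exists k; rewrite !updateE /=; split=> // kL'.
    by have := Lmin k ltac:(lia); lia.
  move=> s2 ag2 [k [kL lk zk pk uk]].
  have kLg : k = Lg.
    apply/eqP; rewrite eqn_leq kL leqNgt; apply/negP => lt.
    (* If [k < Lg], then [n + m <= k < 2 ^ k], so minimality of [Lg] gives [Lg <= k]. *)
    have := uk lt; have : k < 2 ^ k by apply: ltn_expl.
    move=> h1 h2; have := Lmin k ltac:(lia); lia.
  rewrite kLg {k kL uk kLg} in lk zk pk.
  apply: runs_seq.
  apply: (@runs_weaken _ _ (csize parameters * w) _
    (fun s3 => [/\ s3 CROWD 0 = 2 * Lg, s3 MODULI 0 = Q & agree [:: CROWD; MODULI] s2 s3])).
  + by rewrite leq_mul2l wN orbT.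
  + move=> s3 _ [k3 q3 ag3].
    have ag s' : agree (IDX :: mods init_best) s3 s' -> forall A i, A \in [:: LENGTHS; INA; INB; ORDER; FLAG] -> s' A i = s A i.
      by move=> h A i; rewrite !inE => /or4P[|||/orP[]] /eqP->; rewrite h // ag3 // ag2 // ag1.
    have cs s' : agree (IDX :: mods init_best) s3 s' -> ctx s'.
      move=> h; split=> *.
      1-5: by rewrite (ag _ h).
      1-5: by rewrite h // ?k3 ?q3 // ag3 // ?zk ?pk.
    pose J u (s' : store) := forall i, i < u -> s' BEST i = N.
    apply: (@for_lin w N _ J) => //.
    * exact: lt_wN.
    * by move=> s' h; rewrite /= (ctx_N (cs _ h)) lt_wN.
    * move=> u s' hu h su Iu; have c' := cs _ h.
      apply: lin_assign => //=; rewrite ?su ?(ctx_N c').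
      - by do !split => //; apply: lt_wN; lia.
      - by do !split => //; apply: lt_wN; lia.
      move=> _ i; rewrite ltnS leq_eqVlt !updateE /= => /predU1P[->|lt].
        by rewrite eqxx.
      by rewrite (ltn_eqF lt) Iu.
    move=> s' h Is; split; first exact: cs.
    have f0 : s' FLAG 0 = 0 by rewrite (ag _ h) // zero.
    by split=> [i iN|||] //; rewrite ?f0 //; left; apply: Is.
  apply: lin_seq; apply: lin_assign => //=; first by rewrite lk.
  rewrite lk; apply: lin_assign => //=; rewrite ?updateE /= ?lk //.
  split=> //.
  by move=> A i; rewrite !inE !negb_or !updateE => /andP[/negbTE-> /negbTE->].
- apply: lin_seq; apply: lin_assign => //=; apply: lin_assign => //=.
  split=> // A i; rewrite !inE !negb_or !updateE => /andP[/negbTE-> /negbTE->] //.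
by rewrite leq_mul2l wN orbT.
Qed.

(** None of the section variables occurs in it: one fixed program serves all inputs. *)
Definition program : cmd := setup;; solve.

Lemma program_spec s (bad : bool) : (forall k, n + m <= 2 ^ k -> Lg <= k) ->
  s LENGTHS 0 = n -> s LENGTHS 1 = m -> (forall k, s INA k = av k) ->
  (forall k, s INB k = bv k) -> (forall p, s ORDER p = sg p) ->
  (forall A i, OUT <= A -> s A i = 0) -> (crowded -> bad) ->
  runs program s ((setup_const + solve_const) * (N * w ^ 7) +
      bad * (naive_const * (N * N * w)))
    (fun s' => minimal s' /\ forall i, i < n + m -> s' OUT i = sg (s' BEST i)).
Proof.
move=> Lmin en em ea eb es zero hbad.
have le : N * w <= N * w ^ 7 by rewrite leq_mul2l -{1}[w]expn1 leq_pexp2l ?orbT.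
rewrite mulnDl -addnA; apply: runs_seq.
apply: runs_weaken (setup_spec Lmin en em ea eb es zero) => [|s1 _ [c1 inv1]].
  by rewrite leq_mul2l le orbT.
exact: solve_spec.
Qed.

End Program.

(** * Expected running time *)

Section Analysis.

Variables (n m : nat) (a : n.-tuple bool) (b : m.-tuple bool).
Hypotheses (n0 : 0 < n) (m0 : 0 < m).

Local Notation Lg := (up_log 2 (n + m)).
Local Notation N := (2 ^ Lg).
Local Notation w := (10 * Lg).
Local Notation av := (nth false a).
Local Notation bv := (nth false b).

(** Agrees with array 3 of [input] at every cell, including the default 0 beyond [n]. *)
Definition order_fun (sigma : 'S_n) : nat -> nat :=
  nth 0 [seq val (sigma j) | j <- enum 'I_n].

Lemma orderE sigma (p : 'I_n) : order_fun sigma p = sigma p.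
Proof. by rewrite /order_fun (nth_map p) ?size_enum_ord // nth_ord_enum. Qed.

Lemma order_lt sigma p : order_fun sigma p < n.
Proof.
have [pn|np] := ltnP p n; first by rewrite (orderE sigma (Ordinal pn)).
by rewrite /order_fun nth_default // size_map size_enum_ord.
Qed.

Lemma bv_lt j : bv j -> j < m.
Proof. by have [//|h] := ltnP j m; rewrite nth_default // size_tuple. Qed.

Lemma witE sigma i (p : 'I_n) :
  wit n av bv (order_fun sigma) i p = (sigma p \in witnesses a b i).
Proof. by rewrite inE /wit ltn_ord orderE (tnth_nth false) andTb. Qed.

Definition bad (sigma : 'S_n) : bool :=
  [exists i : 'I_N, exists l : 'I_Lg,
     late_crowd (witnesses a b i) (2 ^ l) (2 * Lg) sigma].

Lemma countE sigma h i : rank_count n av bv (order_fun sigma) (fun p => p < h) i =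
  #|[set p : 'I_n | (sigma p \in witnesses a b i) && (p < h)]|.
Proof.
rewrite /rank_count big_mkord -sum1_card [RHS]big_mkcond /=.
by apply: eq_bigr => p _; rewrite andbC witE [in RHS]inE; case: (_ && _).
Qed.

Lemma crowded_bad sigma : crowded n Lg av bv (order_fun sigma) -> bad sigma.
Proof.
move=> [i [l [iN lL late crowd]]].
apply/existsP; exists (Ordinal iN); apply/existsP; exists (Ordinal lL).
apply/andP; split.
  by apply/forallP => p; apply/implyP; rewrite -witE => /late.
have e : 2 ^ l.+1 = (2 ^ l).*2 by rewrite expnS mul2n.
by move: crowd; rewrite countE e => /ltnW.
Qed.

(** Union bound over [N * Lg] pairs of an index and a level; each late crowd has probability at most
    [2 ^ -(2 * Lg)], the inverse square of [N]. *)
Lemma card_bad : (\sum_(sigma : 'S_n) bad sigma) * N <= Lg * n`!.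
Proof.
have N0 : 0 < N by rewrite expn_gt0.
suff : (\sum_(sigma : 'S_n) bad sigma) * 2 ^ (2 * Lg) <= N * (Lg * n`!).
  by rewrite mul2n -addnn expnD mulnA [_ * N]mulnC leq_pmul2l.
apply: (@leq_trans ((\sum_(sigma : 'S_n) \sum_(i < N) \sum_(l < Lg)
    late_crowd (witnesses a b i) (2 ^ l) (2 * Lg) sigma) * 2 ^ (2 * Lg))).
  rewrite leq_mul2r; apply/orP; right; apply: leq_sum => sigma _.
  case: (boolP (bad sigma)) => // /existsP[i /existsP[l h]].
  by rewrite (bigD1 i) //= (bigD1 l) //= h -addnA.
rewrite exchange_big /= big_distrl /=.
apply: (@leq_trans (\sum_(i < N) Lg * n`!)); last by rewrite sum_nat_const card_ord.
apply: leq_sum => i _; rewrite exchange_big /= big_distrl /=.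
apply: (@leq_trans (\sum_(l < Lg) n`!)); last by rewrite sum_nat_const card_ord.
apply: leq_sum => l _.
apply: leq_trans (card_late_crowd (witnesses a b i) (2 ^ l) (2 * Lg)).
rewrite leq_mul2r -sum1_card big_mkcond /= [X in _ <= X]big_mkcond /=.
apply/orP; right; apply: leq_sum => sigma _.
by rewrite inE; case: (late_crowd _ _ _ _).
Qed.

Lemma conv_witness (i : 'I_(n + m).-1) : tnth (conv a b) i ->
  exists k, k \in witnesses a b i.
Proof.
rewrite tnth_mktuple big_orE => /existsP[[k j] /andP[/eqP e /andP[ak bj]]] /=.
exists k; rewrite inE ak -[val i]e leq_addr addKn.
by rewrite -(tnth_nth false).
Qed.

Lemma size_bounds : [/\ n + m <= N, 0 < Lg, Lg <= bits (n + m) & N <= 2 * (n + m)].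
Proof.
have /andP[lt le] := @up_log_bounds 2 (n + m) isT ltac:(lia).
have L0 : 0 < Lg by rewrite lt0n; apply/eqP => e; rewrite e in le; lia.
split=> //; last by rewrite -(prednK L0) expnS; lia.
by rewrite /bits -(prednK L0) ltnS; apply: trunc_log_max => //; apply: ltnW.
Qed.

(** Time and final store form one pair, so that [fin_all_exists] can choose both as functions of
    [sigma]. *)
Lemma program_correct sigma :
  exists u : nat * store,
  [/\ exec program (input a b sigma) u.1 u.2,
     forall i : 'I_(n + m).-1, tnth (conv a b) i ->
         exists2 k : 'I_n, lex_smallest sigma (witnesses a b i) k
           & nth 0 (output (n + m) u.2) i = k &
     u.1 <= (setup_const + solve_const) * (N * w ^ 7) +
      bad sigma * (naive_const * (N * N * w))].
Proof.
have [nmN L0 _ _] := size_bounds.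
have nth_bits l (c : l.-tuple bool) k : nth 0 (map nat_of_bool c) k = nth false c k.
  by have [h|h] := ltnP k (size c); [rewrite (nth_map false) | rewrite !nth_default ?size_map].
have [||||||||t [s [ex le [mins outs]]]] := @program_spec n m Lg av bv (order_fun sigma)
  n0 m0 nmN L0 (order_lt sigma) bv_lt (input a b sigma) (bad sigma) => //.
- by move=> k; apply: up_log_min.
- exact: nth_bits.
- exact: nth_bits.
- by case=> [|[|[|[|A]]]] i // _; rewrite /input [nth [::] _ _]nth_default // nth_nil.
- exact: crowded_bad.
exists (t, s); split=> //= i /conv_witness[k kW].
have iN : i < N by have := ltn_ord i; lia.
have [best_ok best_min] := mins i iN.
have rank k' : k' \in witnesses a b i -> s 10 i <= (sigma^-1)%g k'.
  by move=> k'W; apply: best_min; rewrite witE permKV.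
(* Some witness exists, so array 10, which is [BEST], holds a genuine position and not the default
   [N]. *)
have bn : s 10 i < n by apply: leq_ltn_trans (rank k kW) (ltn_ord _).
have {best_ok} wb : wit n av bv (order_fun sigma) i (s 10 i).
  by case: best_ok => // e; move: bn; rewrite e; lia.
exists (sigma (Ordinal bn)); last first.
  rewrite /output nth_mkseq ?outs; try by have := ltn_ord i; lia.
  exact: (orderE sigma (Ordinal bn)).
split; first by rewrite -witE.
by move=> k' /rank; rewrite permK.
Qed.

End Analysis.

Theorem theorem16 :
  exists (P : cmd) (C e : nat),
  forall (n m : nat) (a : n.-tuple bool) (b : m.-tuple bool),
  0 < n -> 0 < m ->
  exists (T : 'S_n -> nat) (final : 'S_n -> store),
    (forall sigma : 'S_n,
       exec P (input a b sigma) (T sigma) (final sigma) /\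
       forall i : 'I_(n + m).-1, tnth (conv a b) i ->
         exists2 k : 'I_n, lex_smallest sigma (witnesses a b i) k
           & nth 0 (output (n + m) (final sigma)) i = k) /\
    (expectation T <= (C * (n + m) * bits (n + m) ^ e)%:R)%R.
Proof.
pose c1 := setup_const + solve_const.
(* The factor 2 comes from [N <= 2 * (n + m)] and [10 ^ 7] from [w = 10 * Lg]. *)
exists program, ((c1 + naive_const) * (2 * 10 ^ 7)), 7 => n m a b n0 m0.
have [nmN L0 Lb N2] := size_bounds n0 m0.
have [u hu] := fin_all_exists (program_correct a b n0 m0).
exists (fun sigma => (u sigma).1), (fun sigma => (u sigma).2); split.
  by move=> sigma; have [] := hu sigma.
rewrite -/c1 in hu; clearbody c1.
rewrite /expectation Num.Theory.ler_pdivrMr; last by rewrite Num.Theory.ltr0n fact_gt0.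
rewrite -GRing.natr_sum -GRing.natrM Num.Theory.ler_nat.
set Lg := up_log 2 (n + m) in L0 Lb N2 hu.
set N := 2 ^ Lg in N2 hu; set w := 10 * Lg in hu.
have w7 : w * w <= w ^ 7.
  by rewrite mulnn leq_pexp2l //; rewrite /w; lia.
apply: (@leq_trans (\sum_(sigma : 'S_n)
    (c1 * (N * w ^ 7) + bad a b sigma * (naive_const * (N * N * w))))).
  by apply: leq_sum => sigma _; have [] := hu sigma.
rewrite big_split /= sum_nat_const card_Sn -big_distrl /=.
have cb := card_bad a b; rewrite -/Lg -/N in cb.
apply: (@leq_trans ((c1 + naive_const) * (N * w ^ 7) * n`!)).
  rewrite mulnDl mulnDl leq_add //; first by rewrite mulnC.
  (* One factor [N] of the quadratic cost is paired with the number of bad orders, and [card_bad]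
     replaces their product by [Lg * n!]. *)
  have -> : (\sum_(sigma : 'S_n) bad a b sigma) * (naive_const * (N * N * w)) =
    naive_const * (((\sum_(sigma : 'S_n) bad a b sigma) * N) * (N * w)) by lia.
  rewrite -[X in _ <= X]mulnA leq_mul2l; apply/orP; right.
  apply: (@leq_trans (Lg * n`! * (N * w))); first by rewrite leq_mul2r cb orbT.
  have -> : Lg * n`! * (N * w) = N * (Lg * w) * n`! by lia.
  rewrite leq_mul2r leq_mul2l; apply/orP; right; apply/orP; right.
  by apply: leq_trans w7; rewrite leq_mul2r /w leq_pmull ?orbT.
rewrite leq_mul2r; apply/orP; right.
have -> : (c1 + naive_const) * (2 * 10 ^ 7) * (n + m) * bits (n + m) ^ 7 =
    (c1 + naive_const) * (2 * (n + m) * (10 * bits (n + m)) ^ 7).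
  rewrite expnMn; move: (10 ^ 7) (bits (n + m) ^ 7) (c1 + naive_const) => x y z; lia.
by rewrite leq_mul2l leq_mul ?orbT // leq_exp2r // /w leq_mul2l Lb orbT.
Qed.
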